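(* The $UT_2$-algebras $UT_2^F$ and $UT_2^D$ generate two distinct varieties of $UT_2$-algebras of almost polynomial growth.
   Context: $F$ is a field of characteristic zero; all algebras are associative $F$-algebras. $UT_2$ is the algebra of $2\times 2$ upper triangular matrices over $F$, with matrix units $e_{ij}$ and basis $\{1=e_{11}+e_{22},\,e_{22},\,e_{12}\}$. Put $W=UT_2$. A $W$-algebra is an algebra $A$ that is a (unital) $W$-bimodule such that $w(a_1a_2)=(wa_1)a_2$, $(a_1a_2)w=a_1(a_2w)$, $(a_1w)a_2=a_1(wa_2)$ for all $w\in W$, $a_1,a_2\in A$. The free $W$-algebra $W\langle X\rangle$ on $X=\{x_1,x_2,\dots\}$ has as $F$-basis the words $w_{0}x_{j_1}w_{1}x_{j_2}\cdots w_{n-1}x_{j_n}w_{n}$, $n\ge 1$, with $w_0,\dots,w_n$ in the basis $\{1,e_{22},e_{12}\}$ of $W$ ($x_i=1x_i=x_i1$), with juxtaposition product and expansion of products of adjacent coefficients in the basis of $W$. For a $W$-algebra $A$, $\mathrm{GId}(A)$ is the set of $f(x_1,\dots,x_n)\in W\langle X\rangle$ with $f(a_1,\dots,a_n)=0$ for all $a_i\in A$. $GP_n$ is the $F$-span of the elements $w_{0}x_{\sigma(1)}w_{1}\cdots w_{n-1}x_{\sigma(n)}w_{n}$, with $\sigma\in S_n$ and $w_i\in W$, and $gc_n(A)=\dim_F GP_n/(GP_n\cap\mathrm{GId}(A))$. $UT_2^D$ denotes the algebra $UT_2$ with the $UT_2$-algebra structure in which $1$ and $e_{22}$ act by the usual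 left and right multiplication, while $e_{12}\cdot a=a\cdot e_{12}=0$ for all $a\in UT_2$ (extended linearly). $UT_2^F$ denotes the algebra $UT_2$ with the $UT_2$-algebra structure in which $1$ acts by the usual left and right multiplication, while $e_{22}\cdot a=a\cdot e_{22}=0$ and $e_{12}\cdot a=a\cdot e_{12}=0$ for all $a\in UT_2$ (extended linearly). $\mathrm{gvar}(A)$ is the variety of $W$-algebras generated by $A$, i.e. the class of all $W$-algebras $B$ with $\mathrm{GId}(A)\subseteq\mathrm{GId}(B)$. For $\mathcal V=\mathrm{gvar}(A)$ put $\mathrm{GId}(\mathcal V)=\mathrm{GId}(A)$ and $gc_n(\mathcal V)=gc_n(A)$. $\mathcal V$ has polynomial growth if $gc_n(\mathcal V)$, $n\ge1$, is polynomially bounded; it has almost polynomial growth if $gc_n(\mathcal V)$ is not polynomially bounded but every proper generalized subvariety of $\mathcal V$ has polynomial growth. *)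

(* Defs.v *)
From HB Require Import structures.
From mathcomp Require Import all_boot all_order all_algebra.
From mathcomp Require Import perm finmap.
From mathcomp.multinomials Require Import monalg.
From Stdlib Require Import ClassicalEpsilon.

Set Implicit Arguments.
Unset Strict Implicit.
Unset Printing Implicit Defensive.

Import GRing.Theory.
Local Open Scope ring_scope.

(* Indices of rows and columns are 0 and 1, so e12 is [delta_mx 0 1] and e22 is
   [delta_mx 1 1]. *)
Definition upper2 (F : fieldType) : {pred 'M[F]_2} :=
  fun M => M (1 : 'I_2) (0 : 'I_2) == 0.

Fact upper2_subalg (F : fieldType) : subalg_closed (@upper2 F).
Proof.
split; first by rewrite unfold_in mxE.
- by move=> c u v; rewrite !unfold_in !mxE => /eqP-> /eqP->; rewrite mulr0 addr0.
- move=> u v; rewrite !unfold_in !mxE !big_ord_recl big_ord0 => /eqP u0 /eqP v0.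
  have -> : lift 0 0 = 1 :> 'I_2 by apply/val_inj.
  by rewrite u0 v0 mulr0 mul0r !addr0.
Qed.

HB.instance Definition _ (F : fieldType) :=
  GRing.isSubalgClosed.Build F 'M[F]_2 (@upper2 F) (@upper2_subalg F).

Record UT2 (F : fieldType) := MkUT2 { ut2val :> 'M[F]_2; _ : ut2val \in @upper2 F }.

HB.instance Definition _ (F : fieldType) := [isSub for @ut2val F].
HB.instance Definition _ (F : fieldType) := [Choice of UT2 F by <:].
HB.instance Definition _ (F : fieldType) :=
  [SubChoice_isSubAlgebra of UT2 F by <:].

Lemma UT2_10 (F : fieldType) (w : UT2 F) : ut2val w 1 0 = 0.
Proof. by case: w => M /= /eqP. Qed.

Lemma UT2P (F : fieldType) (v w : UT2 F) :
  ut2val v 0 0 = ut2val w 0 0 -> ut2val v 0 1 = ut2val w 0 1 ->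
  ut2val v 1 1 = ut2val w 1 1 -> v = w.
Proof.
move=> h00 h01 h11; apply/val_inj/matrixP=> i j /=.
have d (k : 'I_2) : k = 0 \/ k = 1.
  by case: k => [[|[|k]] hk] //; [left | right]; apply/val_inj.
by case: (d i) => ->; case: (d j) => ->; rewrite ?UT2_10.
Qed.

Lemma UT2_entryM (F : fieldType) (v w : UT2 F) i j :
  ut2val (v * w) i j = ut2val v i 0 * ut2val w 0 j + ut2val v i 1 * ut2val w 1 j.
Proof.
rewrite /= mxE !big_ord_recl big_ord0 addr0.
by have -> : lift 0 0 = 1 :> 'I_2 by apply/val_inj.
Qed.

(* The three labels stand for the basis elements 1, e22 and e12 of UT2. *)
Inductive wbasis := b1 | b22 | b12.

Definition wbasis_code (b : wbasis) : 'I_3 :=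
  match b with
  | b1 => @Ordinal 3 0 isT | b22 => @Ordinal 3 1 isT | b12 => @Ordinal 3 2 isT
  end.
Definition wbasis_decode (i : 'I_3) : wbasis :=
  match val i with 0%N => b1 | 1%N => b22 | _ => b12 end.
Fact wbasis_codeK : cancel wbasis_code wbasis_decode.
Proof. by case. Qed.

HB.instance Definition _ := Finite.copy wbasis (can_type wbasis_codeK).

Fact e22_upper (F : fieldType) : (delta_mx 1 1 : 'M[F]_2) \in @upper2 F.
Proof. by rewrite unfold_in !mxE. Qed.
Fact e12_upper (F : fieldType) : (delta_mx 0 1 : 'M[F]_2) \in @upper2 F.
Proof. by rewrite unfold_in !mxE. Qed.

Definition e22 (F : fieldType) : UT2 F := MkUT2 (e22_upper F).
Definition e12 (F : fieldType) : UT2 F := MkUT2 (e12_upper F).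

Definition wb (F : fieldType) (b : wbasis) : UT2 F :=
  match b with b1 => 1 | b22 => e22 F | b12 => e12 F end.

Definition wcoord (F : fieldType) (b : wbasis) (w : UT2 F) : F :=
  match b with
  | b1 => ut2val w 0 0
  | b22 => ut2val w 1 1 - ut2val w 0 0
  | b12 => ut2val w 0 1
  end.

Lemma big_wbasis (V : nmodType) (f : wbasis -> V) :
  \sum_b f b = f b1 + f b22 + f b12.
Proof.
have e : perm_eq (index_enum wbasis) [:: b1; b22; b12].
  apply: uniq_perm => //; first exact: index_enum_uniq.
  by move=> b; rewrite mem_index_enum; case: b.
by rewrite (perm_big _ e) /= !big_cons big_nil addr0 addrA.
Qed.

Lemma wcoordE (F : fieldType) (w : UT2 F) : w = \sum_b wcoord b w *: wb F b.
Proof.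
rewrite big_wbasis; apply: UT2P; rewrite /= !mxE /=.
- by rewrite !mulr0 !addr0 mulr1.
- by rewrite !mulr0 !add0r mulr1.
- by rewrite !mulr1 mulr0 addr0 addrC subrK.
Qed.

Lemma wcoord_wb (F : fieldType) (b c : wbasis) : wcoord c (wb F b) = (b == c)%:R.
Proof. by case: b; case: c; rewrite /= !mxE /= ?subr0 ?subrr. Qed.

Lemma wcoord_linear (F : fieldType) (b : wbasis) :
  linear_for *%R (wcoord b : UT2 F -> F).
Proof.
case: b => c v w; rewrite /= !mxE //.
by rewrite mulrBr opprD !addrA; congr (_ - _); rewrite addrAC.
Qed.

(* [None] stands for a zero product. *)
Definition wbmul (b c : wbasis) : option wbasis :=
  match b, c with
  | b1, c => Some c
  | b, b1 => Some b
  | b22, b22 => Some b22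
  | b12, b22 => Some b12
  | _, _ => None
  end.

Lemma wb_mul (F : fieldType) (b c : wbasis) :
  wb F b * wb F c = if wbmul b c is Some d then wb F d else 0.
Proof.
case: b; case: c; rewrite ?mul1r ?mulr1 //;
  apply: UT2P; rewrite UT2_entryM /= !mxE /=;
  by rewrite ?(mulr0, mul0r, mulr1, addr0, add0r).
Qed.

(* An associative F-algebra, not necessarily unital, with a unital W-bimodule
   structure whose two induced F-structures are the given one. *)
HB.mixin Record isWAlgebra (F : fieldType) A of GRing.Lmodule F A := {
  wmul : A -> A -> A;
  lact : UT2 F -> A -> A;
  ract : A -> UT2 F -> A;
  wmul_linl : forall b, linear (wmul^~ b);
  wmul_linr : forall a, linear (wmul a);
  wmulA : associative wmul;
  lact_linl : forall a, linear (lact^~ a);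
  lact_linr : forall w, linear (lact w);
  lact1 : forall a, lact 1 a = a;
  lactM : forall v w a, lact (v * w) a = lact v (lact w a);
  ract_linl : forall w, linear (ract^~ w);
  ract_linr : forall a, linear (ract a);
  ract1 : forall a, ract a 1 = a;
  ractM : forall a v w, ract a (v * w) = ract (ract a v) w;
  lract : forall v a w, ract (lact v a) w = lact v (ract a w);
  lact_mul : forall w a b, lact w (wmul a b) = wmul (lact w a) b;
  ract_mul : forall a b w, ract (wmul a b) w = wmul a (ract b w);
  mul_ract_lact : forall a w b, wmul (ract a w) b = wmul a (lact w b)
}.

#[short(type="walgType")]
HB.structure Definition WAlgebra (F : fieldType) :=
  { A of GRing.Lmodule F A & isWAlgebra F A }.

Declare Scope walg_scope.
Delimit Scope walg_scope with WA.
Notation "a ** b" := (wmul a b) (at level 40, left associativity) : walg_scope.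
Notation "w *> a" := (lact w a) (at level 38, right associativity) : walg_scope.
Notation "a <* w" := (ract a w) (at level 39, left associativity) : walg_scope.
Local Open Scope walg_scope.

(* (w_0 a_1) (w_1 a_2) ... (w_(n-1) a_n) w_n for
   s = [:: (w_0, a_1); ...; (w_(n-1), a_n)] and n > 0.  The value at n = 0 is
   junk, since W itself does not embed in a W-algebra. *)
Definition wprod (F : fieldType) (A : walgType F)
    (s : seq (UT2 F * A)) (w : UT2 F) : A :=
  if s is h :: t then
    foldl (fun m p => m ** (p.1 *> p.2)) (h.1 *> h.2) t <* w
  else 0.

Definition UT2D (F : fieldType) : Type := UT2 F.
HB.instance Definition _ (F : fieldType) := GRing.Lmodule.on (UT2D F).

Definition UT2F (F : fieldType) : Type := UT2 F.
HB.instance Definition _ (F : fieldType) := GRing.Lmodule.on (UT2F F).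

Section TwoStructures.
Variable F : fieldType.
Implicit Types (a b : UT2 F) (v w : UT2 F).

Definition lactD w a : UT2 F :=
  wcoord b1 w *: a + wcoord b22 w *: (e22 F * a) + wcoord b12 w *: 0.
Definition ractD a w : UT2 F :=
  wcoord b1 w *: a + wcoord b22 w *: (a * e22 F) + wcoord b12 w *: 0.

Definition lactF w a : UT2 F :=
  wcoord b1 w *: a + wcoord b22 w *: 0 + wcoord b12 w *: 0.
Definition ractF a w : UT2 F :=
  wcoord b1 w *: a + wcoord b22 w *: 0 + wcoord b12 w *: 0.

(* The actions are multiplications by the images of w under two algebra
   endomorphisms of UT2: projection on the diagonal part, and on a scalar. *)
Let dg w : UT2 F := wcoord b1 w *: 1 + wcoord b22 w *: e22 F.
Let sc w : UT2 F := wcoord b1 w *: 1.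

Let lactDE w a : lactD w a = dg w * a.
Proof. by rewrite /lactD /dg scaler0 addr0 mulrDl -!scalerAl mul1r. Qed.
Let ractDE a w : ractD a w = a * dg w.
Proof. by rewrite /ractD /dg scaler0 addr0 mulrDr -!scalerAr mulr1. Qed.
Let lactFE w a : lactF w a = sc w * a.
Proof. by rewrite /lactF /sc !scaler0 !addr0 -scalerAl mul1r. Qed.
Let ractFE a w : ractF a w = a * sc w.
Proof. by rewrite /ractF /sc !scaler0 !addr0 -scalerAr mulr1. Qed.

Let sc_lin c v w : sc (c *: v + w) = c *: sc v + sc w.
Proof. by rewrite /sc wcoord_linear scalerDl -scalerA. Qed.
Let dg_lin c v w : dg (c *: v + w) = c *: dg v + dg w.
Proof.
by rewrite /dg !wcoord_linear 2!scalerDl -!scalerA scalerDr addrACA.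
Qed.
Let sc1 : sc 1 = 1.
Proof. by rewrite /sc /= !mxE /= scale1r. Qed.
Let dg1 : dg 1 = 1.
Proof. by rewrite /dg /= !mxE /= subrr scale0r addr0 scale1r. Qed.
Let coord1M v w : wcoord b1 (v * w) = wcoord b1 v * wcoord b1 w.
Proof. by rewrite /wcoord UT2_entryM UT2_10 mulr0 addr0. Qed.
Let scM v w : sc (v * w) = sc v * sc w.
Proof. by rewrite /sc coord1M -scalerAl mul1r scalerA. Qed.
Let dgM v w : dg (v * w) = dg v * dg w.
Proof.
have dgE u : [/\ ut2val (dg u) 0 0 = ut2val u 0 0, ut2val (dg u) 0 1 = 0
     & ut2val (dg u) 1 1 = ut2val u 1 1].
  rewrite /dg /= !mxE /= !mulr0 !mulr1 !addr0; split=> //.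
  by rewrite addrC subrK.
move: (dg v) (dg w) (dg (v * w)) (dgE v) (dgE w) (dgE (v * w)) => p q r.
move=> [x1 x2 x3] [y1 y2 y3] [z1 z2 z3]; apply: UT2P.
- by rewrite UT2_entryM z1 UT2_entryM x1 y1 !UT2_10 !mulr0.
- by rewrite UT2_entryM z2 y2 x2 mulr0 mul0r addr0.
- by rewrite UT2_entryM z3 UT2_entryM x3 y3 !UT2_10 !mul0r.
Qed.

Let mulP (a : UT2 F) : linear ( *%R a).
Proof. by move=> c x y; rewrite mulrDr -scalerAr. Qed.
Let mulPl (a : UT2 F) : linear ( *%R^~ a).
Proof. by move=> c x y; rewrite mulrDl -scalerAl. Qed.

Definition UT2D_isWAlgebra : isWAlgebra F (UT2D F).
Proof.
refine (@isWAlgebra.Build F (UT2D F) ( *%R : UT2 F -> UT2 F -> UT2 F)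
  lactD ractD (@mulPl) mulP (@mulrA _) _ _ _ _ _ _ _ _ _ _ _ _).
- by move=> a c x y; rewrite !lactDE dg_lin mulPl.
- by move=> w c x y; rewrite !lactDE mulP.
- by move=> a; rewrite lactDE dg1 mul1r.
- by move=> v w a; rewrite !lactDE dgM mulrA.
- by move=> w c x y; rewrite !ractDE mulPl.
- by move=> a c x y; rewrite !ractDE dg_lin mulP.
- by move=> a; rewrite ractDE dg1 mulr1.
- by move=> a v w; rewrite !ractDE dgM mulrA.
- by move=> v a w; rewrite !ractDE !lactDE mulrA.
- by move=> v a w; rewrite !lactDE mulrA.
- by move=> v a w; rewrite !ractDE mulrA.
- by move=> v a w; rewrite !ractDE !lactDE mulrA.
Defined.

Definition UT2F_isWAlgebra : isWAlgebra F (UT2F F).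
Proof.
refine (@isWAlgebra.Build F (UT2F F) ( *%R : UT2 F -> UT2 F -> UT2 F)
  lactF ractF (@mulPl) mulP (@mulrA _) _ _ _ _ _ _ _ _ _ _ _ _).
- by move=> a c x y; rewrite !lactFE sc_lin mulPl.
- by move=> w c x y; rewrite !lactFE mulP.
- by move=> a; rewrite lactFE sc1 mul1r.
- by move=> v w a; rewrite !lactFE scM mulrA.
- by move=> w c x y; rewrite !ractFE mulPl.
- by move=> a c x y; rewrite !ractFE sc_lin mulP.
- by move=> a; rewrite ractFE sc1 mulr1.
- by move=> a v w; rewrite !ractFE scM mulrA.
- by move=> v a w; rewrite !ractFE !lactFE mulrA.
- by move=> v a w; rewrite !lactFE mulrA.
- by move=> v a w; rewrite !ractFE mulrA.
- by move=> v a w; rewrite !ractFE !lactFE mulrA.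
Defined.

End TwoStructures.

HB.instance Definition _ (F : fieldType) := UT2D_isWAlgebra F.
HB.instance Definition _ (F : fieldType) := UT2F_isWAlgebra F.

(* The basis word w_0 x_(j_1) w_1 ... x_(j_n) w_n, n > 0, is encoded as
   ((w_0, j_1), [:: (w_1, j_2); ...; (w_(n-1), j_n)], w_n). *)
Definition word : Type := (wbasis * nat) * seq (wbasis * nat) * wbasis.
HB.instance Definition _ := Countable.on word.

Definition word_letters (u : word) : seq (wbasis * nat) := u.1.1 :: u.1.2.

Definition freeW (F : fieldType) : Type := {malg F[word]}.
HB.instance Definition _ (F : fieldType) := GRing.Lmodule.on (freeW F).

Definition word_mul (u v : word) : option word :=
  if wbmul u.2 v.1.1.1 is Some c
  then Some (u.1.1, u.1.2 ++ (c, v.1.1.2) :: v.1.2, v.2) else None.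
Definition word_lact (b : wbasis) (u : word) : option word :=
  if wbmul b u.1.1.1 is Some c then Some ((c, u.1.1.2), u.1.2, u.2) else None.
Definition word_ract (u : word) (b : wbasis) : option word :=
  if wbmul u.2 b is Some c then Some (u.1, c) else None.

Section LinearExtension.
Variables (F : fieldType) (V : lmodType F).

Definition lext (h : word -> V) (f : freeW F) : V :=
  \sum_(u <- msupp f) f@_u *: h u.

Lemma lextEw (h : word -> V) (f : freeW F) (d : {fset word}) :
  (msupp f `<=` d)%fset -> lext h f = \sum_(u <- d) f@_u *: h u.
Proof.
move=> sd; rewrite /lext (big_fset_incl _ sd) // => u _ uf.
by rewrite mcoeff_outdom // scale0r.
Qed.

Lemma lext_linear (h : word -> V) : linear (lext h).
Proof.
move=> c f g; pose d := (msupp f `|` msupp g `|` msupp (c *: f + g))%fset.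
rewrite (@lextEw h f d) ?(@lextEw h g d) ?(@lextEw h (c *: f + g) d);
  last first.
- by apply: fsubset_trans (fsubsetUl _ _); apply: fsubsetUl.
- by apply: fsubset_trans (fsubsetUl _ _); apply: fsubsetUr.
- by apply: fsubsetUr.
rewrite scaler_sumr -big_split; apply: eq_bigr => u _ /=.
by rewrite mcoeffD mcoeffZ scalerDl scalerA.
Qed.

Lemma lextU (h : word -> V) u : lext h << u >> = h u.
Proof.
by rewrite /lext msuppU oner_eq0 big_seq_fset1 mcoeffUU scale1r.
Qed.

Lemma linear0P (U : lmodType F) (f : U -> V) : linear f -> f 0 = 0.
Proof. by move=> lf; have := lf (-1) 0 0; rewrite !scaleN1r !addNr. Qed.

Lemma linear_sumP (U : lmodType F) (f : U -> V) I (r : seq I) (c : I -> F)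
    (x : I -> U) :
  linear f -> f (\sum_(i <- r) c i *: x i) = \sum_(i <- r) c i *: f (x i).
Proof.
move=> lf; elim: r => [|i r IH]; first by rewrite !big_nil linear0P.
by rewrite !big_cons lf IH.
Qed.

Lemma freeWE (f : freeW F) : f = \sum_(u <- msupp f) f@_u *: (<< u >> : freeW F).
Proof.
rewrite {1}[f]monalgE; apply: eq_bigr => u _.
by apply/malgP => v; rewrite mcoeffZ !mcoeffU mulr_natr.
Qed.

Lemma freeW_ext (f g : freeW F -> V) : linear f -> linear g ->
  (forall u, f << u >> = g << u >>) -> f =1 g.
Proof.
move=> lf lg e x; rewrite (freeWE x) !linear_sumP //.
by apply: eq_bigr => u _; rewrite e.
Qed.

Lemma UT2_ext (f g : UT2 F -> V) : linear f -> linear g ->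
  (forall b, f (wb F b) = g (wb F b)) -> f =1 g.
Proof.
move=> lf lg e x; rewrite (wcoordE x) !linear_sumP //.
by apply: eq_bigr => u _; rewrite e.
Qed.

End LinearExtension.

Section FreeWAlgebra.
Variable F : fieldType.

Definition oword (o : option word) : freeW F := if o is Some u then << u >> else 0.

Definition fmul (f g : freeW F) : freeW F :=
  lext (fun u => lext (fun v => oword (word_mul u v)) g) f.
Definition flact (w : UT2 F) (f : freeW F) : freeW F :=
  lext (fun u => \sum_b wcoord b w *: oword (word_lact b u)) f.
Definition fract (f : freeW F) (w : UT2 F) : freeW F :=
  lext (fun u => \sum_b wcoord b w *: oword (word_ract u b)) f.

Lemma fmul_linl g : linear (fmul^~ g). Proof. exact: lext_linear. Qed.

Lemma lext_add (h k : word -> freeW F) c f :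
  lext (fun u => c *: h u + k u) f = c *: lext h f + lext k f.
Proof.
rewrite /lext scaler_sumr -big_split; apply: eq_bigr => u _ /=.
by rewrite scalerDr !scalerA mulrC.
Qed.

Lemma eq_lext (h k : word -> freeW F) : h =1 k -> lext h =1 lext k.
Proof. by move=> e f; apply: eq_bigr => u _; rewrite e. Qed.

Lemma fmul_linr f : linear (fmul f).
Proof.
move=> c g h; rewrite -lext_add; apply: eq_lext => u; exact: lext_linear.
Qed.

Lemma flact_linr w : linear (flact w). Proof. exact: lext_linear. Qed.
Lemma fract_linl w : linear (fract^~ w). Proof. exact: lext_linear. Qed.

Lemma flact_linl f : linear (flact^~ f).
Proof.
move=> c v w; rewrite -lext_add; apply: eq_lext => u.
rewrite scaler_sumr -big_split; apply: eq_bigr => b _ /=.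
by rewrite wcoord_linear scalerDl scalerA.
Qed.

Lemma fract_linr f : linear (fract f).
Proof.
move=> c v w; rewrite -lext_add; apply: eq_lext => u.
rewrite scaler_sumr -big_split; apply: eq_bigr => b _ /=.
by rewrite wcoord_linear scalerDl scalerA.
Qed.

Lemma wcoord_sum b (h : wbasis -> freeW F) :
  \sum_c wcoord c (wb F b) *: h c = h b.
Proof.
rewrite (bigD1 b) //= big1 => [|c /negPf nb].
  by rewrite wcoord_wb eqxx scale1r addr0.
by rewrite wcoord_wb eq_sym nb scale0r.
Qed.

Lemma fmulO o p : fmul (oword o) (oword p) =
  oword (if o is Some u then if p is Some v then word_mul u v else None else None).
Proof.
case: o => [u|]; last exact: (linear0P (fmul_linl _)).
case: p => [v|]; last exact: (linear0P (fmul_linr _)).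
by rewrite /fmul !lextU.
Qed.

Lemma flactO b o :
  flact (wb F b) (oword o) = oword (if o is Some u then word_lact b u else None).
Proof.
case: o => [u|]; last exact: (linear0P (flact_linr _)).
by rewrite /flact lextU wcoord_sum.
Qed.

Lemma fractO b o :
  fract (oword o) (wb F b) = oword (if o is Some u then word_ract u b else None).
Proof.
case: o => [u|]; last exact: (linear0P (fract_linl _)).
by rewrite /fract lextU wcoord_sum.
Qed.

Lemma oword_ext (f g : freeW F -> freeW F) : linear f -> linear g ->
  (forall u, f (oword (Some u)) = g (oword (Some u))) -> f =1 g.
Proof. exact: freeW_ext. Qed.

Let linC (U : lmodType F) (f : freeW F -> freeW F) (g : U -> freeW F) :
  linear f -> linear g -> linear (fun x => f (g x)).
Proof. by move=> lf lg c x y; rewrite lg lf. Qed.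

Lemma fmulA : associative fmul.
Proof.
move=> f g h; move: f; apply: oword_ext => [||u].
- exact: fmul_linl.
- exact: (linC (fmul_linl h) (fmul_linl g)).
move: g; apply: oword_ext => [||v].
- exact: (linC (fmul_linr _) (fmul_linl h)).
- exact: (linC (fmul_linl h) (fmul_linr _)).
move: h; apply: oword_ext => [||z].
- exact: (linC (fmul_linr _) (fmul_linr _)).
- exact: fmul_linr.
rewrite (fmulO (Some v)) fmulO (fmulO (Some u)) fmulO; congr oword.
case: u v z => [[[u0 i] s] u1] [[[v0 j] t] v1] [[[z0 k] r] z1].
rewrite /word_mul /=.
by case e1: (wbmul v1 z0) => [c|]; case e2: (wbmul u1 v0) => [d|] //=;
  rewrite ?e1 ?e2 // -catA.
Qed.

Lemma flact1 f : flact 1 f = f.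
Proof.
move: f; apply: oword_ext => [||[[[b i] s] u]] //; first exact: flact_linr.
exact: (flactO b1).
Qed.

Lemma fract1 f : fract f 1 = f.
Proof.
move: f; apply: oword_ext => [||[[[b i] s] u]] //; first exact: fract_linl.
by rewrite (fractO b1); case: u.
Qed.

Lemma wbmulO b c (V : lmodType F) (f : UT2 F -> V) : linear f ->
  f (wb F b * wb F c) = if wbmul b c is Some d then f (wb F d) else 0.
Proof. by move=> lf; rewrite wb_mul; case: wbmul => //; apply: linear0P. Qed.

Let mul_linl (V : lmodType F) (f : UT2 F -> V) w :
  linear f -> linear (fun v => f (v * w)).
Proof. by move=> lf c x y; rewrite mulrDl -scalerAl lf. Qed.
Let mul_linr (V : lmodType F) (f : UT2 F -> V) w :
  linear f -> linear (fun v => f (w * v)).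
Proof. by move=> lf c x y; rewrite mulrDr -scalerAr lf. Qed.

Lemma flactM v w f : flact (v * w) f = flact v (flact w f).
Proof.
move: f; apply: oword_ext => [||u].
- exact: flact_linr.
- exact: (linC (flact_linr v) (flact_linr w)).
move: v; apply: UT2_ext => [||b].
- exact: (mul_linl w (flact_linl _)).
- exact: flact_linl.
move: w; apply: UT2_ext => [||c].
- exact: (mul_linr _ (flact_linl _)).
- exact: (linC (flact_linr _) (flact_linl _)).
rewrite (wbmulO b c (flact_linl _)) (flactO c) (flactO b).
transitivity (oword (if wbmul b c is Some d then word_lact d u else None)).
  by case: wbmul => // d; rewrite (flactO d).
by congr oword; case: u => [[[d i] s] u]; case: b; case: c; case: d.
Qed.

Lemma fractM f v w : fract f (v * w) = fract (fract f v) w.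
Proof.
move: f; apply: oword_ext => [||u].
- exact: fract_linl.
- exact: (linC (fract_linl w) (fract_linl v)).
move: v; apply: UT2_ext => [||b].
- exact: (mul_linl w (fract_linr _)).
- exact: (linC (fract_linl w) (fract_linr _)).
move: w; apply: UT2_ext => [||c].
- exact: (mul_linr _ (fract_linr _)).
- exact: fract_linr.
rewrite (wbmulO b c (fract_linr _)) (fractO b) (fractO c).
transitivity (oword (if wbmul b c is Some d then word_ract u d else None)).
  by case: wbmul => // d; rewrite (fractO d).
by congr oword; case: u => [[[d i] s] u]; case: b; case: c; case: u.
Qed.

Lemma flract v f w : fract (flact v f) w = flact v (fract f w).
Proof.
move: f; apply: oword_ext => [||u].
- exact: (linC (fract_linl w) (flact_linr v)).
- exact: (linC (flact_linr v) (fract_linl w)).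
move: v; apply: UT2_ext => [||b].
- exact: (linC (fract_linl w) (flact_linl _)).
- exact: flact_linl.
move: w; apply: UT2_ext => [||c].
- exact: fract_linr.
- exact: (linC (flact_linr _) (fract_linr _)).
rewrite (flactO b) (fractO c) (fractO c) (flactO b); congr oword.
case: u => [[[d i] s] u]; rewrite /word_lact /word_ract /=.
by case e1: (wbmul b d) => [p|]; case e2: (wbmul u c) => [q|] //=;
  rewrite ?e1 ?e2.
Qed.

Lemma flact_mul w f g : flact w (fmul f g) = fmul (flact w f) g.
Proof.
move: f; apply: oword_ext => [||u].
- exact: (linC (flact_linr w) (fmul_linl g)).
- exact: (linC (fmul_linl g) (flact_linr w)).
move: w; apply: UT2_ext => [||b].
- exact: flact_linl.
- exact: (linC (fmul_linl g) (flact_linl _)).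
move: g; apply: oword_ext => [||v].
- exact: (linC (flact_linr _) (fmul_linr _)).
- exact: fmul_linr.
rewrite (flactO b) (fmulO (Some u)) (flactO b) fmulO; congr oword.
case: u v => [[[u0 i] s] u1] [[[v0 j] t] v1]; rewrite /word_lact /word_mul /=.
by case e1: (wbmul b u0) => [p|]; case e2: (wbmul u1 v0) => [q|] //=;
  rewrite ?e1 ?e2.
Qed.

Lemma fract_mul f g w : fract (fmul f g) w = fmul f (fract g w).
Proof.
move: f; apply: oword_ext => [||u].
- exact: (linC (fract_linl w) (fmul_linl g)).
- exact: fmul_linl.
move: w; apply: UT2_ext => [||b].
- exact: fract_linr.
- exact: (linC (fmul_linr _) (fract_linr _)).
move: g; apply: oword_ext => [||v].
- exact: (linC (fract_linl _) (fmul_linr _)).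
- exact: (linC (fmul_linr _) (fract_linl _)).
rewrite (fractO b (Some v)) (fmulO (Some u) (Some v)) (fractO b) fmulO.
congr oword.
case: u v => [[[u0 i] s] u1] [[[v0 j] t] v1]; rewrite /word_ract /word_mul /=.
by case e1: (wbmul v1 b) => [p|]; case e2: (wbmul u1 v0) => [q|] //=;
  rewrite ?e1 ?e2.
Qed.

Lemma fmul_ract_lact f w g : fmul (fract f w) g = fmul f (flact w g).
Proof.
move: f; apply: oword_ext => [||u].
- exact: (linC (fmul_linl g) (fract_linl w)).
- exact: fmul_linl.
move: w; apply: UT2_ext => [||b].
- exact: (linC (fmul_linl g) (fract_linr _)).
- exact: (linC (fmul_linr _) (flact_linl g)).
move: g; apply: oword_ext => [||v].
- exact: fmul_linr.
- exact: (linC (fmul_linr _) (flact_linr _)).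
rewrite (fractO b (Some u)) (flactO b (Some v)) !fmulO; congr oword.
case: u v => [[[u0 i] s] u1] [[[v0 j] t] v1].
by case: u1; case: b; case: v0.
Qed.

Definition freeW_isWAlgebra : isWAlgebra F (freeW F) :=
  @isWAlgebra.Build F (freeW F) fmul flact fract
    fmul_linl fmul_linr fmulA flact_linl flact_linr flact1 flactM
    fract_linl fract_linr fract1 fractM flract flact_mul fract_mul
    fmul_ract_lact.

End FreeWAlgebra.

HB.instance Definition _ (F : fieldType) := freeW_isWAlgebra F.

Definition wvar (F : fieldType) (i : nat) : freeW F := << ((b1, i), [::], b1) >>.

#[local] Arguments wprod : simpl never.

Section Evaluation.
Variables (F : fieldType) (A : walgType F).

Definition weval_word (a : nat -> A) (u : word) : A :=
  wprod [seq (wb F p.1, a p.2) | p <- word_letters u] (wb F u.2).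

Definition weval (a : nat -> A) (f : freeW F) : A := lext (weval_word a) f.

Lemma weval_linear a : linear (weval a). Proof. exact: lext_linear. Qed.

Lemma wmul0l (x : A) : 0 ** x = 0. Proof. exact: (linear0P (wmul_linl x)). Qed.
Lemma wmul0r (x : A) : x ** 0 = 0. Proof. exact: (linear0P (wmul_linr x)). Qed.
Lemma lact0l (x : A) : 0 *> x = 0. Proof. exact: (linear0P (lact_linl x)). Qed.
Lemma lact0r w : w *> (0 : A) = 0. Proof. exact: (linear0P (lact_linr w)). Qed.
Lemma ract0l w : (0 : A) <* w = 0. Proof. exact: (linear0P (ract_linl w)). Qed.
Lemma ract0r (x : A) : x <* 0 = 0. Proof. exact: (linear0P (ract_linr x)). Qed.

Let step (m : A) (p : UT2 F * A) := m ** (p.1 *> p.2).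

Let step_mul x h (t : seq (UT2 F * A)) : x ** foldl step h t = foldl step (x ** h) t.
Proof. by elim: t h => //= p t IH h; rewrite IH /step wmulA. Qed.
Let step_lact w h (t : seq (UT2 F * A)) : w *> foldl step h t = foldl step (w *> h) t.
Proof. by elim: t h => //= p t IH h; rewrite IH /step lact_mul. Qed.
Let step0 (t : seq (UT2 F * A)) : foldl step 0 t = 0.
Proof. by elim: t => //= p t IH; rewrite {2}/step wmul0l. Qed.

Lemma wprod_mul p (s : seq (UT2 F * A)) v w x t w' :
  wprod (p :: s) v ** wprod ((w, x) :: t) w' = wprod (p :: s ++ (v * w, x) :: t) w'.
Proof.
rewrite /wprod -ract_mul -/step step_mul mul_ract_lact -lactM.
by rewrite foldl_cat.
Qed.

Lemma wprod_lact v w x (t : seq (UT2 F * A)) w' :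
  v *> wprod ((w, x) :: t) w' = wprod ((v * w, x) :: t) w'.
Proof. by rewrite /wprod -lract -/step step_lact -lactM. Qed.

Lemma wprod_ract (s : seq (UT2 F * A)) v w :
  wprod s v <* w = wprod s (v * w).
Proof. by case: s => [|p s]; rewrite /wprod ?ract0l // -ractM. Qed.

Lemma wprod0 (s t : seq (UT2 F * A)) x w : wprod (s ++ (0, x) :: t) w = 0.
Proof.
rewrite /wprod; case: s => [|p s] /=; first by rewrite lact0l step0 ract0l.
by rewrite foldl_cat /= lact0l wmul0r step0 ract0l.
Qed.

Lemma weval_oword a o : weval a (oword F o) =
  if o is Some u then weval_word a u else 0.
Proof.
case: o => [u|]; first exact: lextU.
exact: (linear0P (weval_linear a)).
Qed.

Lemma weval_var a i : weval a (wvar F i) = a i.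
Proof. by rewrite /weval lextU /weval_word /wprod /= lact1 ract1. Qed.

Let linC (U V W : lmodType F) (f : V -> W) (g : U -> V) :
  linear f -> linear g -> linear (fun x => f (g x)).
Proof. by move=> lf lg c x y; rewrite lg lf. Qed.

Lemma weval_mul a f g : weval a (f ** g) = weval a f ** weval a g.
Proof.
move: f; apply: freeW_ext => [||u].
- exact: (linC (weval_linear a) (wmul_linl g)).
- exact: (linC (wmul_linl _) (weval_linear a)).
move: g; apply: freeW_ext => [||v].
- exact: (linC (weval_linear a) (wmul_linr _)).
- exact: (linC (wmul_linr _) (weval_linear a)).
rewrite -[_ ** _]/(fmul (oword F (Some u)) (oword F (Some v))) fmulO.
rewrite -[<< u >>]/(oword F (Some u)) -[<< v >>]/(oword F (Some v)) !weval_oword.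
case: u v => [[[u0 i] s] u1] [[[v0 j] t] v1].
rewrite /weval_word /word_letters /= wprod_mul wb_mul /word_mul /=.
case: (wbmul u1 v0) => [c|]; last by rewrite -cat_cons wprod0.
by rewrite /weval_word /= map_cat.
Qed.

Lemma weval_lact a w f : weval a (w *> f) = w *> weval a f.
Proof.
move: f; apply: freeW_ext => [||u].
- exact: (linC (weval_linear a) (lact_linr w)).
- exact: (linC (lact_linr w) (weval_linear a)).
move: w; apply: UT2_ext => [||b].
- exact: (linC (weval_linear a) (lact_linl _)).
- exact: lact_linl.
rewrite -[_ *> _]/(flact (wb F b) (oword F (Some u))) flactO.
rewrite -[<< u >>]/(oword F (Some u)) !weval_oword.
case: u => [[[u0 i] s] u1].
rewrite /weval_word /word_letters /= wprod_lact wb_mul /word_lact /=.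
case: (wbmul b u0) => [c|] //.
by rewrite -[_ :: _]cat0s wprod0.
Qed.

Lemma weval_ract a f w : weval a (f <* w) = weval a f <* w.
Proof.
move: f; apply: freeW_ext => [||u].
- exact: (linC (weval_linear a) (ract_linl w)).
- exact: (linC (ract_linl w) (weval_linear a)).
move: w; apply: UT2_ext => [||b].
- exact: (linC (weval_linear a) (ract_linr _)).
- exact: ract_linr.
rewrite -[_ <* _]/(fract (oword F (Some u)) (wb F b)) fractO.
rewrite -[<< u >>]/(oword F (Some u)) !weval_oword.
case: u => [[[u0 i] s] u1].
rewrite /weval_word wprod_ract wb_mul /word_ract /=.
by case: (wbmul u1 b) => [c|] //; rewrite /wprod /= ract0r.
Qed.

(* Together with the lemmas above: [freeW F] is free on [wvar F]. *)
Lemma weval_unique (a : nat -> A) (phi : freeW F -> A) :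
  linear phi -> (forall f g, phi (f ** g) = phi f ** phi g) ->
  (forall w f, phi (w *> f) = w *> phi f) ->
  (forall f w, phi (f <* w) = phi f <* w) ->
  (forall i, phi (wvar F i) = a i) -> phi =1 weval a.
Proof.
move=> lphi pM pl pr pv; apply: freeW_ext => //; first exact: weval_linear.
case=> [[[u0 i] s] u1]; rewrite /weval lextU.
elim/last_ind: s u1 => [|s [b j] IH] u1.
  rewrite /weval_word /wprod /= -pv -pl -pr; congr phi.
  rewrite -[_ *> _]/(flact (wb F u0) (oword F (Some _))) flactO.
  by rewrite -[_ <* _]/(fract _ _) fractO; case: u0.
have E : << ((u0, i), rcons s (b, j), u1) >> =
    (<< ((u0, i), s, b1) >> : freeW F) ** (wb F b *> wvar F j <* wb F u1).
  rewrite -[_ *> _]/(flact (wb F b) (oword F (Some _))) flactO.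
  rewrite -[_ <* _]/(fract _ _) fractO.
  rewrite -[<< ((u0, i), s, b1) >>]/(oword F (Some ((u0, i), s, b1))).
  rewrite -[_ ** _]/(fmul _ _) fmulO -cats1.
  by case: b.
rewrite {}E; set x := << _ >>; set y := _ <* _.
have yE : phi y = wb F b *> a j <* wb F u1 by rewrite /y pr pl pv.
rewrite (pM x y) yE {}/x IH.
rewrite /weval_word /word_letters /wprod /= map_rcons -cats1 foldl_cat /= ract1.
by rewrite ract_mul.
Qed.

End Evaluation.

(* The variables x_1, x_2, ... are [wvar F 0], [wvar F 1], ... *)
Definition GId (F : fieldType) (A : walgType F) (f : freeW F) : Prop :=
  forall a : nat -> A, weval a f = 0.

Definition gmultilinear (F : fieldType) (n : nat) (s : 'S_n)
    (w : nat -> UT2 F) : freeW F :=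
  wprod [seq (w (val i), wvar F (s i)) | i <- enum 'I_n] (w n).

Definition GP (F : fieldType) (n : nat) (f : freeW F) : Prop :=
  exists (m : nat) (c : 'I_m -> F) (s : 'I_m -> 'S_n)
      (w : 'I_m -> nat -> UT2 F),
    f = \sum_(k < m) c k *: gmultilinear (s k) (w k).

Section QuotientDimension.
Variables (F : fieldType) (V : lmodType F).

Definition free_mod (I : V -> Prop) (d : nat) (e : 'I_d -> V) : Prop :=
  forall c : 'I_d -> F, I (\sum_(i < d) c i *: e i) -> forall i, c i = 0.

Definition spans_mod (I : V -> Prop) (d : nat) (e : 'I_d -> V) (f : V) : Prop :=
  exists c : 'I_d -> F, I (f - \sum_(i < d) c i *: e i).

(* The classes of e_1, ..., e_d form a basis of U / (U \cap I). *)
Definition quotient_basis (U I : V -> Prop) (d : nat) (e : 'I_d -> V) : Prop :=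
  [/\ forall i, U (e i), free_mod I e & forall f, U f -> spans_mod I e f].

(* This is dim_F U / (U \cap I) as soon as the latter is finite. *)
Definition quotient_dim (U I : V -> Prop) : nat :=
  epsilon (inhabits 0%N)
    (fun d => exists e : 'I_d -> V, quotient_basis U I e).

Definition subspace (I : V -> Prop) : Prop :=
  I 0 /\ forall c u v, I u -> I v -> I (c *: u + v).

Lemma subspaceZ I : subspace I -> forall c u, I u -> I (c *: u).
Proof. by move=> [I0 Il] c u Iu; rewrite -[_ *: _]addr0; apply: Il. Qed.

Lemma subspaceD I : subspace I -> forall u v, I u -> I v -> I (u + v).
Proof. by move=> [I0 Il] u v Iu Iv; rewrite -[u]scale1r; apply: Il. Qed.

Lemma subspace_sum I : subspace I -> forall J (r : seq J) (x : J -> V),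
  (forall j, I (x j)) -> I (\sum_(j <- r) x j).
Proof.
move=> sI J r x Ix; elim: r => [|j r IH]; first by rewrite big_nil; case: sI.
by rewrite big_cons; apply: subspaceD.
Qed.

Lemma steinitz_mod I d (e : 'I_d -> V) N (g : 'I_N -> V) : subspace I ->
  free_mod I e -> (forall i, spans_mod I g (e i)) -> (d <= N)%N.
Proof.
move=> sI fe sg; rewrite leqNgt; apply/negP => ltNd.
pose c i := proj1_sig (constructive_indefinite_description _ (sg i)).
have cP i : I (e i - \sum_(j < N) c i j *: g j).
  exact: proj2_sig (constructive_indefinite_description _ (sg i)).
pose M : 'M[F]_(d, N) := \matrix_(i, j) c i j.
pose u := nz_row (kermx M).
have u0 : u != 0.
  rewrite nz_row_eq0 -mxrank_eq0 mxrank_ker subn_eq0 -ltnNge.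
  exact: leq_ltn_trans (rank_leq_col _) ltNd.
have uM : u *m M = 0 by apply/sub_kermxP/nz_row_sub.
case/eqP: u0; apply/rowP => i; rewrite mxE; apply: (fe (u 0)).
have -> : \sum_i0 u 0 i0 *: e i0 =
    \sum_i0 u 0 i0 *: (e i0 - \sum_(j < N) c i0 j *: g j).
  apply/esym; under eq_bigr => k _ do rewrite scalerBr scaler_sumr.
  rewrite big_split /= sumrN exchange_big /= [X in _ - X]big1 ?subr0 // => j _.
  under eq_bigr => k _ do rewrite scalerA.
  rewrite -scaler_suml; have /rowP/(_ j) := uM; rewrite !mxE => uMj.
  have -> : \sum_k u 0 k * c k j = 0; last by rewrite scale0r.
  by rewrite -[RHS]uMj; apply: eq_bigr => k _; rewrite mxE.
by apply: subspace_sum => // k; apply: subspaceZ.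
Qed.

Lemma quotient_basis_exists (U I : V -> Prop) N (g : 'I_N -> V) : subspace I ->
  (forall f, U f -> spans_mod I g f) ->
  exists d (e : 'I_d -> V), quotient_basis U I e.
Proof.
move=> sI sg.
pose P d := exists e : 'I_d -> V, (forall i, U (e i)) /\ free_mod I e.
pose p d : bool := if excluded_middle_informative (P d) then true else false.
have pP d : reflect (P d) (p d).
  by rewrite /p; case: excluded_middle_informative => h; constructor.
have p0 : exists d, p d.
  by exists 0%N; apply/pP; exists (fun _ => 0); split=> [[]|c _ []].
have pN d : p d -> (d <= N)%N.
  move=> /pP[e [Ue fe]]; apply: (steinitz_mod sI fe) => i; exact: sg.
case: (ex_maxnP p0 pN) => d /pP[e [Ue fe]] dmax; exists d, e; split=> // f Uf.
have nP : ~ P d.+1 by move=> /pP /dmax; rewrite ltnn.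
pose e' (i : 'I_d.+1) := if unlift ord_max i is Some j then e j else f.
have e'l j : e' (lift ord_max j) = e j by rewrite /e' liftK.
have e'm : e' ord_max = f by rewrite /e' unlift_none.
have [c cI cn] : exists2 c : 'I_d.+1 -> F, I (\sum_i c i *: e' i)
    & exists i, c i <> 0.
  apply: NNPP => nc; case: nP; exists e'; split=> [i|c cI i].
    by rewrite /e'; case: unlift.
  by apply: NNPP => ci; apply: nc; exists c => //; exists i.
move: cI; rewrite big_ord_recr /= e'm.
under eq_bigr => i _.
  have -> : widen_ord (leqnSn d) i = lift ord_max i.
    by apply: val_inj; rewrite /= /bump leqNgt ltn_ord.
  rewrite e'l; over.
move=> cI; case: (eqVneq (c ord_max) 0) => [c0|cn0].
  case: cn => i []; move: cI; rewrite c0 scale0r addr0 => /fe cj.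
  by case: (unliftP ord_max i) => [j|] ->.
exists (fun i => - (c ord_max)^-1 * c (lift ord_max i)).
suff -> : f - \sum_(i < d) (- (c ord_max)^-1 * c (lift ord_max i)) *: e i =
   (c ord_max)^-1 *: (\sum_(i < d) c (lift ord_max i) *: e i + c ord_max *: f).
  exact: subspaceZ.
rewrite scalerDr scalerA mulVf // scale1r addrC scaler_sumr -sumrN; congr (_ + _).
by apply: eq_bigr => i _; rewrite mulNr scaleNr opprK scalerA.
Qed.

Lemma quotient_dimP (U I : V -> Prop) N (g : 'I_N -> V) : subspace I ->
  (forall f, U f -> spans_mod I g f) ->
  exists e : 'I_(quotient_dim U I) -> V, quotient_basis U I e.
Proof. by move=> sI /(quotient_basis_exists sI); apply: epsilon_spec. Qed.

Lemma quotient_dimE (U I : V -> Prop) d (e : 'I_d -> V) : subspace I ->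
  quotient_basis U I e -> quotient_dim U I = d.
Proof.
move=> sI qe.
have qex : exists d (e : 'I_d -> V), quotient_basis U I e by exists d, e.
have [e' [Ue' fe' se']] := epsilon_spec (inhabits 0%N) _ qex.
case: qe => Ue fe se; apply/eqP; rewrite eqn_leq.
apply/andP; split; [apply: (steinitz_mod sI fe') | apply: (steinitz_mod sI fe)].
- by move=> i; apply: se.
- by move=> i; apply: se'.
Qed.

End QuotientDimension.

Definition gcodim (F : fieldType) (I : freeW F -> Prop) (n : nat) : nat :=
  quotient_dim (GP (F := F) n) I.

Section CodimensionFinite.
Variables (F : fieldType).

Let in_span (V : lmodType F) (G : seq V) (f : V) : Prop :=
  exists c : nat -> F, f = \sum_(i < size G) c i *: G`_i.

Let span_sub (V : lmodType F) (G : seq V) : subspace (in_span G).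
Proof.
split; first by exists (fun _ => 0); rewrite big1 // => i _; rewrite scale0r.
move=> c u v [a ->] [b ->]; exists (fun i => c * a i + b i).
rewrite scaler_sumr -big_split; apply: eq_bigr => i _ /=.
by rewrite scalerDl scalerA.
Qed.

Let mem_span (V : lmodType F) (G : seq V) g : g \in G -> in_span G g.
Proof.
move=> gG; have ig : (index g G < size G)%N by rewrite index_mem.
exists (fun i => (i == index g G)%:R).
rewrite (bigD1 (Ordinal ig)) //= big1 => [|i ni].
  by rewrite eqxx scale1r addr0 nth_index.
by rewrite -val_eqE /= in ni; rewrite (negPf ni) scale0r.
Qed.

Let span_ext (V V' : lmodType F) (f : V -> V') (G : seq V) (S : V' -> Prop) x :
  linear f -> subspace S -> (forall g, g \in G -> S (f g)) -> in_span G x -> S (f x).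
Proof.
move=> lf sS fG [c ->]; rewrite linear_sumP //; apply: subspace_sum => // i.
by apply: subspaceZ => //; apply/fG/mem_nth.
Qed.

Let UT2_span (V : lmodType F) (f : UT2 F -> V) (S : V -> Prop) w :
  linear f -> subspace S -> (forall b, S (f (wb F b))) -> S (f w).
Proof.
move=> lf sS fb; rewrite (wcoordE w) linear_sumP //.
by apply: subspace_sum => // b; apply: subspaceZ.
Qed.

Let wprod_span (A : walgType F) (T : Type) (r : seq T) (x : T -> A) :
  exists G : seq A, forall (w : T -> UT2 F) v,
    in_span G (wprod [seq (w i, x i) | i <- r] v).
Proof.
case: r => [|h t].
  by exists [::] => w v; rewrite /wprod /=; case: (span_sub (Nil A)).
have [G GP] : exists G : seq A, forall w : T -> UT2 F,
    in_span G (foldl (fun m p => m ** (p.1 *> p.2)) (w h *> x h)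
      [seq (w i, x i) | i <- t]).
  elim/last_ind: t => [|t j [G IH]].
    exists [seq wb F b *> x h | b <- enum {: wbasis}] => w /=.
    apply: (UT2_span (f := fun v => v *> x h)); first exact: lact_linl.
      exact: span_sub.
    by move=> b; apply/mem_span/map_f; rewrite mem_enum.
  exists [seq g ** (wb F b *> x j) | g <- G, b <- enum {: wbasis}] => w.
  rewrite map_rcons -cats1 foldl_cat /=.
  apply: (span_ext (f := fun m => m ** (w j *> x j))) (IH w).
  - exact: wmul_linl.
  - exact: span_sub.
  move=> g gG; apply: (UT2_span (f := fun v => g ** (v *> x j))).
  - by move=> c y z; rewrite lact_linl wmul_linr.
  - exact: span_sub.
  by move=> b; apply/mem_span/allpairs_f; rewrite ?mem_enum.
exists [seq g <* wb F b | g <- G, b <- enum {: wbasis}] => w v; rewrite /wprod /=.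
apply: (span_ext (f := fun m => m <* v)) (GP w).
- exact: ract_linl.
- exact: span_sub.
move=> g gG; apply: (UT2_span (f := fun v => g <* v)).
- exact: ract_linr.
- exact: span_sub.
by move=> b; apply/mem_span/allpairs_f; rewrite ?mem_enum.
Qed.

Lemma GP_finite n : exists N (g : 'I_N -> freeW F), forall I f,
  subspace I -> GP n f -> spans_mod I g f.
Proof.
pose H s := constructive_indefinite_description _
  (wprod_span (enum 'I_n) (fun i => wvar F (s i : 'I_n))).
pose G := flatten [seq proj1_sig (H s) | s : 'S_n].
exists (size G), (fun i => G`_i) => I f sI [m [c [s [w ->]]]].
have [b ->] : in_span G (\sum_(k < m) c k *: gmultilinear (s k) (w k)).
  apply: subspace_sum => [|k]; first exact: span_sub.
  apply: subspaceZ; first exact: span_sub.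
  apply: (span_ext (f := id) (S := in_span G))
    (proj2_sig (H (s k)) (w k \o val) (w k n)).
  - by [].
  - exact: span_sub.
  move=> g gH; apply/mem_span/flattenP; exists (proj1_sig (H (s k))) => //.
  by apply: map_f; rewrite mem_enum.
by exists b; rewrite subrr; case: sI.
Qed.

Lemma gcodimP (I : freeW F -> Prop) n : subspace I ->
  exists e : 'I_(gcodim I n) -> freeW F, quotient_basis (GP n) I e.
Proof.
move=> sI; have [N [g gP]] := GP_finite n.
by apply: (quotient_dimP (g := g)) => // f; apply: gP.
Qed.

Lemma GId_subspace (A : walgType F) : subspace (GId A).
Proof.
split=> [a|c f g If Ig a]; first exact: (linear0P (weval_linear a)).
by rewrite weval_linear If Ig scaler0 addr0.
Qed.

End CodimensionFinite.

Section Varieties.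
Variable F : fieldType.

Definition wclass : Type := walgType F -> Prop.

Definition subclass (U V : wclass) : Prop := forall B, U B -> V B.
Definition eqclass (U V : wclass) : Prop := subclass U V /\ subclass V U.

Definition gmodels (S : freeW F -> Prop) : wclass :=
  fun B => forall f, S f -> GId B f.

Definition gvariety (V : wclass) : Prop := exists S, eqclass V (gmodels S).

Definition gvar (A : walgType F) : wclass := gmodels (GId A).

Definition GIdV (V : wclass) (f : freeW F) : Prop := forall B, V B -> GId B f.

Lemma GIdV_gvar (A : walgType F) f : GIdV (gvar A) f <-> GId A f.
Proof. by split=> [|Af B]; [apply | apply]. Qed.

Lemma GIdV_subspace (V : wclass) : subspace (GIdV V).
Proof.
split=> [B _|c f g If Ig B VB]; first by case: (GId_subspace B).
by case: (GId_subspace B) => _; apply; [apply: If | apply: Ig].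
Qed.

Definition gc (V : wclass) (n : nat) : nat := gcodim (GIdV V) n.

Lemma gc_gvar (A : walgType F) n : gc (gvar A) n = gcodim (GId A) n.
Proof.
have [e [Ue fe se]] := gcodimP n (GId_subspace A).
apply: (quotient_dimE (e := e)); first exact: GIdV_subspace.
split=> // [c /GIdV_gvar|f /se [c If]]; first exact: fe.
by exists c; apply/GIdV_gvar.
Qed.

Definition polynomial_growth (V : wclass) : Prop :=
  exists C k : nat, forall n, (0 < n)%N -> (gc V n <= C * n ^ k)%N.

Definition almost_polynomial_growth (V : wclass) : Prop :=
  ~ polynomial_growth V /\
  forall U, gvariety U -> subclass U V -> ~ subclass V U -> polynomial_growth U.

End Varieties.

(* Main.v *)
Require Import Defs.
From mathcomp Require Import all_boot all_order all_algebra.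
From mathcomp Require Import perm finmap ring zify.
From mathcomp.multinomials Require Import monalg.
From Stdlib Require Import ClassicalEpsilon.

(* Each algebra B of the two varieties has an ideal C of square zero containing
   the commutators, on which the coefficients act by scalars, so that left
   multiplications L_x and right multiplications R_x commute on C.  The words
   L_I R_J applied to an element of C are what makes the codimensions of UT2
   exponential.  A further identity f yields, by expanding at
   x_j = a_j y + b_j z + c_j c with c in C, a nontrivial polynomial relation
   between L_y, R_y, L_z, R_z on C.  Polarizing it, and comparing the
   substitution of a product u v for u with the multiplication by v, one reaches
   the relation L_(x_1)..L_(x_m) D_(y_1)..D_(y_m) R_(z_1)..R_(z_m) = 0 on C, with
   D = L - R, which leaves only polynomially many of the words L_I R_J. *)

Set Implicit Arguments.
Unset Strict Implicit.
Unset Printing Implicit Defensive.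

Import GRing.Theory.
Local Open Scope ring_scope.
Local Open Scope walg_scope.

(** * Multiplication operators *)

(** Algebras of a subvariety need not have a unit, so no variable can be replaced by 1 to strip
    operators from a relation. This is why letters L and R survive beside the letters D in the final
    relation. The passage from UT2 to an arbitrary B rests on uniformity: the part of f linear in c
    is one fixed combination of operator words, determined by f, by the scalars a_j, b_j, c_j and by
    the two functions through which coefficients act on C. Evaluated in UT2 at y = e11, z = e22, c =
    e12, it keeps only the words in L_y and R_z, and some coefficient there is seen to be nonzero;
    evaluated in an algebra where f vanishes, the same combination is zero on C. Two elements y, z
    are used so that left and right multiplications can be told apart by idempotents. Characteristic
    zero provides enough scalars to separate homogeneous components, and allows the integer factors
    produced by differentiation to be cancelled. *)

Section LinearMaps.
Variables (F : fieldType) (U V : lmodType F) (f : U -> V).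
Hypothesis lf : linear f.

Lemma islinearD x y : f (x + y) = f x + f y.
Proof. by rewrite -[x]scale1r lf !scale1r. Qed.

Lemma islinearZ c x : f (c *: x) = c *: f x.
Proof. by rewrite -[c *: x]addr0 lf (linear0P lf) addr0. Qed.

Lemma islinearB x y : f (x - y) = f x - f y.
Proof. by rewrite islinearD -scaleN1r islinearZ scaleN1r. Qed.

Lemma islinear_sum I (r : seq I) (P : pred I) (x : I -> U) :
  f (\sum_(i <- r | P i) x i) = \sum_(i <- r | P i) f (x i).
Proof.
elim: r => [|i r IH]; first by rewrite !big_nil (linear0P lf).
by rewrite !big_cons; case: (P i); rewrite ?islinearD IH.
Qed.

End LinearMaps.

Section Products.
Variables (F : fieldType) (A : walgType F).
Implicit Types (x y c d : A) (w : UT2 F).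

Lemma wmulDl x y c : (x + y) ** c = x ** c + y ** c.
Proof. exact: (islinearD (wmul_linl c)). Qed.
Lemma wmulDr c x y : c ** (x + y) = c ** x + c ** y.
Proof. exact: (islinearD (wmul_linr c)). Qed.
Lemma wmulBl x y c : (x - y) ** c = x ** c - y ** c.
Proof. exact: (islinearB (wmul_linl c)). Qed.
Lemma wmulBr c x y : c ** (x - y) = c ** x - c ** y.
Proof. exact: (islinearB (wmul_linr c)). Qed.
Lemma wmulZl a x c : (a *: x) ** c = a *: (x ** c).
Proof. exact: (islinearZ (wmul_linl c)). Qed.
Lemma wmulZr a c x : c ** (a *: x) = a *: (c ** x).
Proof. exact: (islinearZ (wmul_linr c)). Qed.

Definition wcomm x y := x ** y - y ** x.

(** The value 0 on the empty list is a default, as there is no unit to return. *)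
Definition wseqprod (s : seq A) : A := if s is h :: t then foldl (@wmul F A) h t else 0.

(* The kinds [Some true], [Some false], [None] stand for left multiplication,
   right multiplication and their difference. *)
Definition wop (k : option bool) x c : A :=
  match k with
  | Some true => x ** c
  | Some false => c ** x
  | None => x ** c - c ** x
  end.

Definition wops (l : seq (option bool * A)) c : A :=
  foldr (fun q => wop q.1 q.2) c l.

Lemma wops_cons q l c : wops (q :: l) c = wop q.1 q.2 (wops l c).
Proof. by []. Qed.

Lemma wops_cat l l' c : wops (l ++ l') c = wops l (wops l' c).
Proof. by rewrite /wops foldr_cat. Qed.

Lemma wop_linr k x : linear (wop k x).
Proof.
case: k => [[]|] a c d /=; [exact: wmul_linr | exact: wmul_linl |].
by rewrite wmulDl wmulDr wmulZl wmulZr scalerBr addrACA opprD.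
Qed.

Lemma wop_linl k c : linear (wop k ^~ c).
Proof.
case: k => [[]|] a x y /=; [exact: wmul_linl | exact: wmul_linr |].
by rewrite wmulDl wmulDr wmulZl wmulZr scalerBr addrACA opprD.
Qed.

Lemma wops_linear l : linear (wops l).
Proof. by elim: l => // q l IH a c d; rewrite !wops_cons IH wop_linr. Qed.

Lemma wopsLE (s : seq A) c : s != [::] ->
  wops [seq (Some true, x) | x <- s] c = wseqprod s ** c.
Proof.
case: s => //= h t _; elim: t h => //= y t IH h.
by rewrite -IH /= wmulA.
Qed.

Lemma wopsRE (s : seq A) c :
  wops [seq (Some false, x) | x <- rev s] c = foldl (@wmul F A) c s.
Proof.
elim: s c => //= y s IH c.
by rewrite rev_cons map_rcons -cats1 wops_cat IH.
Qed.

(** Singling out one factor turns an ordinary product into a word L_I R_J. The right factors are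
    reversed because the head of an operator list is applied last. *)
Lemma wseqprod_catE (s t : seq A) x :
  wseqprod (s ++ x :: t) =
  wops ([seq (Some true, y) | y <- s] ++ [seq (Some false, y) | y <- rev t]) x.
Proof.
rewrite wops_cat wopsRE; case: s => [|h s] //.
rewrite wopsLE //= foldl_cat /=.
by elim: t x => //= y t IH x; rewrite -wmulA IH.
Qed.

Lemma wseqprod_cat2E (s t : seq A) x y :
  wseqprod (s ++ x :: y :: t) =
  wops ([seq (Some true, y) | y <- s] ++ [seq (Some false, y) | y <- rev t]) (x ** y).
Proof.
by rewrite wseqprod_catE rev_cons map_rcons -cats1 catA wops_cat.
Qed.

End Products.

Section Morphisms.
Variables (F : fieldType) (A : walgType F) (a : nat -> A).

Lemma weval_wprod (s : seq (UT2 F * freeW F)) w :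
  weval a (wprod s w) = wprod [seq (p.1, weval a p.2) | p <- s] w.
Proof.
rewrite /wprod; case: s => [|h t] /=; first exact: (linear0P (weval_linear a)).
rewrite weval_ract; congr (_ <* _); rewrite -weval_lact.
elim: t (_ *> _) => //= p t IH m; rewrite IH; congr foldl.
by rewrite -weval_lact -weval_mul.
Qed.

Lemma weval_wop k f g : weval a (wop k f g) = wop k (weval a f) (weval a g).
Proof.
case: k => [[]|] /=; try exact: weval_mul.
rewrite (islinearB (weval_linear a)); congr (_ - _); exact: weval_mul.
Qed.

Lemma weval_wops l f :
  weval a (wops l f) = wops [seq (q.1, weval a q.2) | q <- l] (weval a f).
Proof. by elim: l => // q l IH; rewrite map_cons !wops_cons weval_wop IH. Qed.

Lemma weval_wseqprod s : weval a (wseqprod s) = wseqprod [seq weval a x | x <- s].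
Proof.
case: s => [|h t] /=; first exact: (linear0P (weval_linear a)).
by elim: t h => //= y t IH h; rewrite IH; congr foldl; exact: weval_mul.
Qed.

Lemma weval_sub (b : nat -> freeW F) f :
  weval a (weval b f) = weval (fun i => weval a (b i)) f.
Proof.
move: f; apply: (weval_unique (phi := fun f => weval a (weval b f))).
- move=> c x y.
  by rewrite weval_linear weval_linear.
- by move=> x y; rewrite weval_mul weval_mul.
- by move=> w x; rewrite weval_lact weval_lact.
- by move=> x w; rewrite weval_ract weval_ract.
- by move=> i; rewrite weval_var.
Qed.

Lemma weval_closed (C : A -> Prop) f : subspace C ->
  (forall x y, C x -> C y -> C (x ** y)) -> (forall w x, C x -> C (w *> x)) ->
  (forall x w, C x -> C (x <* w)) -> (forall i, C (a i)) -> C (weval a f).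
Proof.
move=> sC CM Cl Cr Ca; apply: (subspace_sum sC) => u; apply: (subspaceZ sC).
case: u => [[[u0 i] s] u1]; rewrite /weval_word /wprod /=; apply: Cr.
have : C (wb F u0 *> a i) by apply: Cl.
by elim: s (_ *> _) => //= p s IH m Cm; apply: IH; apply: CM => //; apply: Cl.
Qed.

End Morphisms.

(** * Polarization and elimination on a split ideal *)

Lemma natf_neq0_pchar0 (F : fieldType) (n : nat) :
  [pchar F] =i pred0 -> (n.+1%:R != 0 :> F).
Proof. by move=> /pcharf0P ->. Qed.

(** Lagrange interpolation: the nodes 0, ..., N - 1 are distinct in characteristic zero, so a column
    of the inverse Vandermonde matrix combines the values there into the coefficient of degree [p].
    Exponents may repeat in [r], hence the sum over a fiber of [d]. *)
Lemma coef_extract (F : fieldType) (V : lmodType F) (T : Type) (r : seq T)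
    (d : T -> nat) (v : T -> V) : [pchar F] =i pred0 ->
  (forall t : F, \sum_(x <- r) t ^+ d x *: v x = 0) ->
  forall p, \sum_(x <- r | d x == p) v x = 0.
Proof.
move=> charF r0 p; pose N := (maxn p (\max_(x <- r) d x)).+1.
have pN : (p < N)%N by rewrite ltnS leq_maxl.
have dN : all (fun x => d x < N)%N r.
  suff : all (fun x => d x <= \max_(x <- r) d x)%N r.
    by apply: sub_all => x dx; rewrite ltnS (leq_trans dx) // leq_maxr.
  elim: (r) => //= x s IH; rewrite big_cons leq_maxl /=.
  by apply: sub_all IH => y /leq_trans; apply; rewrite leq_maxr.
pose M := Vandermonde N (\row_(j < N) (j%:R : F)).
have Mu : M \in unitmx.
  rewrite unitmxE det_Vandermonde unitfE; apply/prodf_neq0 => i _.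
  apply/prodf_neq0 => j ij; rewrite !mxE -natrB 1?ltnW //.
  by rewrite (proj1 (pcharf0P F) charF) subn_eq0 -ltnNge.
pose K := invmx M; pose q := Ordinal pN.
have MK (i : 'I_N) : \sum_(j < N) j%:R ^+ i * K j q = (i == p :> nat)%:R.
  transitivity ((M *m K) i q); last by rewrite mulmxV // mxE.
  by rewrite mxE; apply: eq_bigr => j _; rewrite !mxE.
transitivity (\sum_(j < N) K j q *: \sum_(x <- r) j%:R ^+ d x *: v x); last first.
  by rewrite big1 // => j _; rewrite r0 scaler0.
under [RHS]eq_bigr => j _ do rewrite scaler_sumr.
rewrite exchange_big /= big_mkcond /=.
elim: (r) dN => [|x s IH] /=; first by rewrite !big_nil.
case/andP=> dx /IH {}IH; rewrite !big_cons IH; congr (_ + _).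
under [RHS]eq_bigr => j _ do rewrite scalerA mulrC.
rewrite -scaler_suml (MK (Ordinal dx)) /=.
by case: eqP; rewrite ?scale1r ?scale0r.
Qed.

Section Curves.
Variables (F : fieldType) (V : lmodType F).

(** Polarization needs only the derivative [v1] at 0; [v0] is carried along because the product rule
    for [v1] involves it. *)
Definition poly_curve (h : F -> V) (v0 v1 : V) : Prop :=
  exists r : seq (nat * V),
    [/\ forall t, h t = \sum_(x <- r) t ^+ x.1 *: x.2,
        \sum_(x <- r | x.1 == 0%N) x.2 = v0 & \sum_(x <- r | x.1 == 1%N) x.2 = v1].

Lemma poly_curve_const c : poly_curve (fun _ => c) c 0.
Proof.
by exists [:: (0%N, c)]; split=> [t||]; rewrite !big_cons !big_nil /=
  ?expr0 ?scale1r ?addr0.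
Qed.

(** Product rule for the operator f + t g applied to a curve. The conclusion is [poly_curve]
    unfolded, its values lying in another module. *)
Lemma poly_curve_affine (W : lmodType F) (f g : V -> W) h v0 v1 :
  linear f -> linear g -> poly_curve h v0 v1 ->
  exists r : seq (nat * W),
    [/\ forall t, f (h t) + t *: g (h t) = \sum_(x <- r) t ^+ x.1 *: x.2,
        \sum_(x <- r | x.1 == 0%N) x.2 = f v0
      & \sum_(x <- r | x.1 == 1%N) x.2 = f v1 + g v0].
Proof.
move=> lf lg [r [hE <- <-]].
exists ([seq (x.1, f x.2) | x <- r] ++ [seq (x.1.+1, g x.2) | x <- r]); split.
- move=> t; rewrite big_cat !big_map /= hE; congr (_ + _).
    by rewrite (islinear_sum lf); apply: eq_bigr => x _; rewrite islinearZ.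
  rewrite (islinear_sum lg) scaler_sumr; apply: eq_bigr => x _.
  by rewrite islinearZ // scalerA exprS.
- by rewrite big_cat !big_map /= [X in _ + X]big1 // addr0 (islinear_sum lf).
- by rewrite big_cat !big_map /= (islinear_sum lf) (islinear_sum lg).
Qed.

Lemma poly_curve_sum n (h : 'I_n -> F -> V) v0 v1 :
  (forall i, poly_curve (h i) (v0 i) (v1 i)) ->
  poly_curve (fun t => \sum_i h i t) (\sum_i v0 i) (\sum_i v1 i).
Proof.
move=> hP; elim: n h v0 v1 hP => [|n IH] h v0 v1 hP.
  by exists [::]; split=> [t||]; rewrite big_ord0 big_nil.
have [r [rE r0 r1]] := IH (fun i => h (lift ord0 i)) _ _ (fun i => hP (lift ord0 i)).
have [s [sE s0 s1]] := hP ord0.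
by exists (s ++ r); split=> [t||]; rewrite big_ord_recl big_cat /=
  -?rE ?sE ?r0 ?r1 ?s0 ?s1.
Qed.

Lemma poly_curve_eq0 h v0 v1 : [pchar F] =i pred0 ->
  poly_curve h v0 v1 -> (forall t, h t = 0) -> v1 = 0.
Proof.
move=> charF [r [hE _ <-]] h0; apply: (coef_extract charF) => t.
by rewrite -hE.
Qed.

End Curves.

(** Adjacent transpositions suffice: the head of [t] is moved to the front of [s] by swaps, then
    absorbed into the predicate for the induction. *)
Lemma perm_swap_ind (T : eqType) (P : seq T -> Prop) :
  (forall s x y t, P (s ++ x :: y :: t) -> P (s ++ y :: x :: t)) ->
  forall s t, perm_eq s t -> P s -> P t.
Proof.
move=> Psw s t; elim: t P Psw s => [|x t IH] P Psw s.
  by move=> /perm_size/eqP; rewrite size_eq0 => /eqP ->.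
move=> st; have xs : x \in s by rewrite (perm_mem st) mem_head.
case/splitPr: xs st => s1 s2 st.
have {}st : perm_eq (s1 ++ s2) t.
  by rewrite -(perm_cons x) -(permPr st) -cat1s -[x :: s2]cat1s perm_catCA.
have mv (s3 : seq T) : P (s1 ++ x :: s3) -> P (x :: s1 ++ s3).
  elim/last_ind: s1 s3 {st} => // s1 y IHs s3.
  rewrite -cats1 -!catA => Ps; apply: IHs.
  exact: Psw.
move=> /mv; apply: (IH (fun s => P (x :: s))) st => s3 y z s4.
by rewrite -!cat_cons; apply: Psw.
Qed.

(* In an algebra of the variety of UT2F this will be the ideal generated by the
   commutators, in an algebra of the variety of UT2D the Peirce space e11 B e22. *)
Record split_ideal (F : fieldType) (A : walgType F) (chl chr : UT2 F -> F)
    (C : A -> Prop) : Prop := SplitIdeal {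
  split_sub : subspace C;
  split_mull : forall x c, C c -> C (x ** c);
  split_mulr : forall c x, C c -> C (c ** x);
  split_comm : forall x y, C (wcomm x y);
  split_sq : forall c d, C c -> C d -> c ** d = 0;
  split_lact : forall w c, C c -> w *> c = chl w *: c;
  split_ract : forall c w, C c -> c <* w = chr w *: c
}.

Section SplitIdeal.
Variables (F : fieldType) (A : walgType F) (chl chr : UT2 F -> F) (C : A -> Prop).
Hypothesis sC : split_ideal chl chr C.
Implicit Types (x y c d : A) (k : option bool) (l : seq (option bool * A)).

Lemma split_wop k x c : C c -> C (wop k x c).
Proof.
move=> Cc; have [Cl Cr] := (split_mull sC x Cc, split_mulr sC x Cc).
case: k => [[]|] //=; rewrite -scaleN1r; apply: (subspaceD (split_sub sC)) => //.
by apply: (subspaceZ (split_sub sC)).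
Qed.

Lemma split_wops l c : C c -> C (wops l c).
Proof. by move=> Cc; elim: l => // q l IH; apply: split_wop. Qed.

(** Commutators lie in C and C has square zero, so [u, v] c = c [u, v] = 0: left multiplications
    commute on C, and so do right ones. A left and a right multiplication commute by
    associativity. *)
Lemma wop_comm k k' x y c : C c -> wop k x (wop k' y c) = wop k' y (wop k x c).
Proof.
move=> Cc.
have LL u v : u ** (v ** c) = v ** (u ** c).
  by apply/subr0_eq; rewrite !wmulA -wmulBl (split_sq sC (split_comm sC u v) Cc).
have RR u v : c ** u ** v = c ** v ** u.
  by apply/subr0_eq; rewrite -!wmulA -wmulBr (split_sq sC Cc (split_comm sC u v)).
have some u v b b' :
    wop (Some b) u (wop (Some b') v c) = wop (Some b') v (wop (Some b) u c).
  by case: b; case: b' => /=; rewrite ?wmulA // -!wmulA.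
have D u d : wop None u d = wop (Some true) u d - wop (Some false) u d by [].
have step u v b k2 : wop k2 u (wop (Some b) v c) = wop (Some b) v (wop k2 u c).
  case: k2 => [b'|]; first exact: some.
  rewrite !D (islinearB (wop_linr _ _)).
  by rewrite (some u v true) (some u v false).
case: k' => [b|]; first exact: step.
rewrite !D (islinearB (wop_linr _ _)).
by rewrite (step x y true) (step x y false).
Qed.

(** Right multiplication reverses products, which commutation on C repairs. Only the one-sided kinds
    are multiplicative. *)
Lemma wop_mul b x y c : C c ->
  wop (Some b) (x ** y) c = wop (Some b) x (wop (Some b) y c).
Proof. by case: b => Cc; [|rewrite wop_comm //]; rewrite /= wmulA. Qed.

Lemma wops_perm l l' c : C c -> perm_eq l l' -> wops l c = wops l' c.
Proof.
move=> Cc ll'; apply: (perm_swap_ind (P := fun l' => wops l c = wops l' c)) ll' _ => //.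
move=> s p q t ->; rewrite !wops_cat !wops_cons wop_comm //; exact: split_wops.
Qed.

(** Derivative of an n-th power: commutation on C gathers the n terms of the product rule into a
    single one. *)
Lemma poly_curve_nseq n k x u h v0 v1 : C v0 -> poly_curve h v0 v1 ->
  poly_curve (fun t => wops (nseq n (k, x + t *: u)) (h t))
    (wops (nseq n (k, x)) v0)
    (wops (nseq n (k, x)) v1 + n%:R *: wops (nseq n.-1 (k, x)) (wop k u v0)).
Proof.
move=> Cv0; elim: n => [|n IH] hP; first by rewrite scale0r addr0.
have [r [rE r0 r1]] := poly_curve_affine (wop_linr k x) (wop_linr k u) (IH hP).
exists r; split=> [t||].
- by rewrite -rE wops_cons (islinearD (wop_linl _ _)) (islinearZ (wop_linl _ _)).
- by rewrite r0.
rewrite r1 !(islinearD (wop_linr _ _)) !(islinearZ (wop_linr _ _)) -addrA.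
congr (_ + _).
have -> : wop k u (wops (nseq n (k, x)) v0) = wops (nseq n (k, x)) (wop k u v0).
  transitivity (wops ((k, u) :: nseq n (k, x)) v0) => //.
  rewrite -[wop k u v0]/(wops [:: (k, u)] v0) -wops_cat.
  by apply: wops_perm => //; rewrite perm_sym perm_catC.
case: n {IH hP r rE r0 r1} => [|n]; first by rewrite !scale0r add0r scale1r.
by rewrite -[n.+2%:R]natr1 scalerDl scale1r.
Qed.

End SplitIdeal.

Section Elimination.
Variables (F : fieldType) (A : walgType F) (chl chr : UT2 F -> F) (C : A -> Prop).
Hypothesis charF : [pchar F] =i pred0.
Hypothesis sC : split_ideal chl chr C.
Implicit Types (x y c d : A) (k : option bool) (l : seq (option bool * A)).

(** A homogeneous form of degree [p] in the two multiplications by [x], its coefficients [m i] being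
    elements of the module; [b] chooses whose exponent is [i]. *)
Definition biform b p x (m : nat -> A) : A :=
  \sum_(i < p.+1)
    wops (nseq i (Some b, x) ++ nseq (p - i) (Some (~~ b), x)) (m i).

(** The new form is the derivative at [x] in the direction [u]. Its coefficient at index [i]
    collects the derivatives of the terms [i.+1] and [i]. *)
Lemma biform_polarize b p (m : nat -> A) : (forall i, C (m i)) ->
  (forall x, biform b p.+1 x m = 0) -> forall x u,
  biform b p x (fun i => i.+1%:R *: wop (Some b) u (m i.+1)
                         + (p.+1 - i)%:R *: wop (Some (~~ b)) u (m i)) = 0.
Proof.
move=> Cm m0 x u.
pose h (i : 'I_p.+2) t := wops (nseq i (Some b, x + t *: u) ++
   nseq (p.+1 - i) (Some (~~ b), x + t *: u)) (m i).
pose N i j := wops (nseq i (Some b, x) ++ nseq j (Some (~~ b), x)).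
have hP (i : 'I_p.+2) : poly_curve (h i) (N i (p.+1 - i)%N (m i))
    ((p.+1 - i)%:R *: N i (p.+1 - i).-1 (wop (Some (~~ b)) u (m i))
     + i%:R *: N i.-1 (p.+1 - i)%N (wop (Some b) u (m i))).
  have c1 := poly_curve_nseq sC (p.+1 - i) (Some (~~ b)) x u (Cm i)
    (poly_curve_const (m i)).
  have Cn : C (wops (nseq (p.+1 - i) (Some (~~ b), x)) (m i)) by apply: (split_wops sC).
  have := poly_curve_nseq sC i (Some b) x u Cn c1.
  rewrite (linear0P (wops_linear _)) add0r (islinearZ (wops_linear _)).
  have -> : wops (nseq i.-1 (Some b, x))
      (wop (Some b) u (wops (nseq (p.+1 - i) (Some (~~ b), x)) (m i)))
      = N i.-1 (p.+1 - i)%N (wop (Some b) u (m i)).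
    rewrite /N wops_cat; congr wops.
    rewrite -[wop _ _ _]/(wops ((Some b, u) :: nseq (p.+1 - i) (Some (~~ b), x)) (m i)).
    rewrite -[X in _ = wops _ X]/(wops [:: (Some b, u)] (m i)) -wops_cat.
    by apply: (wops_perm sC) => //; rewrite perm_sym perm_catC.
  case=> r [rE r0 r1]; exists r; split=> [t||].
  - by rewrite -rE /h wops_cat.
  - by rewrite r0 /N wops_cat.
  - by rewrite r1 /N !wops_cat.
have := poly_curve_eq0 charF (poly_curve_sum hP).
(* The extreme term of each sum carries the factor 0; dropping both aligns the indices. *)
rewrite big_split /= big_ord_recr /= subnn scale0r addr0.
rewrite [X in _ + X]big_ord_recl /= scale0r add0r -big_split /= => E.
rewrite -[RHS]E => [|t]; last by rewrite -[RHS](m0 (x + t *: u)).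
apply: eq_bigr => i _.
rewrite (islinearD (wops_linear _)) !(islinearZ (wops_linear _)) addrC.
have ip : (i <= p)%N by rewrite -ltnS.
by rewrite /bump /= add1n add0n subSS (subSn ip).
Qed.

(* Polarizing turns the relation into one of degree [p] with coefficients
   [m' i] bilinear in [m i], [m i.+1] and a new element [u]; replacing [u] by a
   product [u ** v] multiplies the two summands of [m' p] by different
   operators, which leaves the difference operator of [v]. *)
Lemma biform_elim b p (m : nat -> A) : (forall i, C (m i)) ->
  (forall x, biform b p x m = 0) -> forall xs vs, size xs = p -> size vs = p ->
  wops ([seq (None, v) | v <- vs] ++ [seq (Some b, x) | x <- xs]) (m p) = 0.
Proof.
elim: p m => [|p IH] m Cm m0 xs vs.
  move=> /size0nil -> /size0nil ->; rewrite -[RHS](m0 0) /biform.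
  by rewrite big_ord_recl big_ord0 addr0.
case: xs vs => [|u xs] // [|v vs] //= [sx] [sv].
pose L : seq (option bool * A) :=
  [seq (None, v) | v <- vs] ++ [seq (Some b, x) | x <- xs].
pose m1 := m p.+1; pose m2 := m p.
have E w : p.+1%:R *: wops L (wop (Some b) w m1) + wops L (wop (Some (~~ b)) w m2) = 0.
  rewrite -(islinearZ (wops_linear _)) -(islinearD (wops_linear _)).
  have := IH _ _ (biform_polarize Cm m0 ^~ w) xs vs sx sv.
  rewrite subSnn scale1r; apply=> i.
  apply: (subspaceD (split_sub sC)); apply: (subspaceZ (split_sub sC));
    exact: (split_wop sC).
have E2 : p.+1%:R *: wops L (wop (Some b) u (wop (Some b) v m1))
    - p.+1%:R *: wops L (wop (Some b) u (wop (Some (~~ b)) v m1)) = 0.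
  have sw k w k' d : C d -> wop k w (wops L (wop k' u d)) = wops L (wop k' u (wop k w d)).
    move=> Cd; transitivity (wops ((k, w) :: L ++ [:: (k', u)]) d).
      by rewrite wops_cons wops_cat.
    transitivity (wops (L ++ [:: (k', u); (k, w)]) d); last by rewrite wops_cat.
    by apply: (wops_perm sC) => //; rewrite -cat1s perm_catC -catA.
  (* [E (u ** v)] and the image of [E u] under [wop (Some (~~ b)) v] have the same term in [m2], so
     their difference involves [m1] only. *)
  have e1 := E (u ** v); rewrite !(wop_mul sC) in e1; try exact: Cm.
  have e2 := congr1 (wop (Some (~~ b)) v) (E u).
  rewrite (linear0P (wop_linr _ _)) (islinearD (wop_linr _ _)) in e2.
  rewrite (islinearZ (wop_linr _ _)) !sw in e2; try exact: Cm.
  have := congr2 (fun y z => y - z) e1 e2.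
  by rewrite opprD addrACA subrr addr0 subr0.
have {E2} : wops L (wop (Some b) u (wop None v m1)) = 0.
  have : wops L (wop (Some b) u (wop (Some b) v m1 - wop (Some (~~ b)) v m1)) = 0.
    apply: (scalerI (natf_neq0_pchar0 p charF)); rewrite scaler0 -[RHS]E2.
    by rewrite (islinearB (wop_linr _ _)) (islinearB (wops_linear _)) scalerBr.
  case: (b) => //= e.
  by rewrite -[v ** m1 - _]opprB -scaleN1r wmulZl (islinearZ (wops_linear _)) e scaler0.
rewrite -[wop (Some b) u _]/(wops [:: (Some b, u); (None, v)] m1) -wops_cat => e.
transitivity (wops ((None, v) :: [seq (None, v) | v <- vs]
    ++ (Some b, u) :: [seq (Some b, x) | x <- xs]) m1) => //.
rewrite -[RHS]e; apply: (wops_perm sC); first exact: Cm.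
apply/seq.permP => a; rewrite /L !count_cat /= count_cat /=; ring.
Qed.

End Elimination.

Lemma sum_fibers (V : nmodType) (T : Type) (r : seq T) (P : pred T) (d : T -> nat) N
    (v : T -> V) : all (fun x => d x < N)%N r ->
  \sum_(i < N) \sum_(x <- r | P x && (d x == i)) v x = \sum_(x <- r | P x) v x.
Proof.
elim: r => [_|x r IH /= /andP[dx /IH {}IH]].
  by rewrite big_nil big1 // => i _; rewrite big_nil.
rewrite big_cons -IH; case Px: (P x).
  rewrite (bigD1 (Ordinal dx)) //= big_cons Px eqxx /= -addrA; congr (_ + _).
  rewrite [in RHS](bigD1 (Ordinal dx)) //=; congr (_ + _); apply: eq_bigr => i ni.
  by rewrite big_cons Px /= ifN // eq_sym.
by apply: eq_bigr => i _; rewrite big_cons Px.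
Qed.

(* A combination of words in the operators of two elements; the letter
   [(b, w)] is the multiplication by [y w], on the left when [b] holds. *)
Definition opcomb (F : fieldType) : Type := seq (F * seq (bool * bool)).

Section OpComb.
Variables (F : fieldType) (A : walgType F).
Implicit Types (s : opcomb F) (y : bool -> A) (c : A).

Definition opword y (t : seq (bool * bool)) c : A :=
  wops [seq (Some q.1, y q.2) | q <- t] c.

Definition opcomb_eval y s c : A := \sum_(q <- s) q.1 *: opword y q.2 c.

Lemma opcomb_cat y s s' c :
  opcomb_eval y (s ++ s') c = opcomb_eval y s c + opcomb_eval y s' c.
Proof. exact: big_cat. Qed.

Lemma opcomb_scale y a s c :
  opcomb_eval y [seq (a * q.1, q.2) | q <- s] c = a *: opcomb_eval y s c.
Proof.
rewrite /opcomb_eval big_map scaler_sumr; apply: eq_bigr => q _.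
by rewrite scalerA.
Qed.

Lemma opcomb_cons y l s c :
  opcomb_eval y [seq (q.1, l :: q.2) | q <- s] c =
  wop (Some l.1) (y l.2) (opcomb_eval y s c).
Proof.
rewrite /opcomb_eval big_map (islinear_sum (wop_linr _ _)); apply: eq_bigr => q _.
by rewrite (islinearZ (wop_linr _ _)).
Qed.

Lemma opcomb_rcons y l s c :
  opcomb_eval y [seq (q.1, rcons q.2 l) | q <- s] c =
  opcomb_eval y s (wop (Some l.1) (y l.2) c).
Proof.
rewrite /opcomb_eval big_map; apply: eq_bigr => q _.
by rewrite /opword /= map_rcons -cats1 wops_cat.
Qed.

Lemma opcomb_linear y s : linear (opcomb_eval y s).
Proof.
move=> a c d; rewrite /opcomb_eval scaler_sumr -big_split; apply: eq_bigr => q _.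
by rewrite /opword (wops_linear _) scalerDr !scalerA mulrC.
Qed.

Lemma split_opcomb chl chr C y s c :
  split_ideal chl chr C -> C c -> C (opcomb_eval y s c).
Proof.
move=> sC Cc; apply: (subspace_sum (split_sub sC)) => q.
by apply: (subspaceZ (split_sub sC)); apply: (split_wops sC).
Qed.

End OpComb.

(* First-order expansion, along [c], of the evaluation at
   [al j *: y true + be j *: y false + ga j *: c]; terms of degree two in [c]
   vanish as the square of a split ideal is zero. *)
Section Expansion.
Variables (F : fieldType) (chl chr : UT2 F -> F) (al be ga : nat -> F).

Let lin (A : walgType F) (y : bool -> A) j := al j *: y true + be j *: y false.
Let pt (A : walgType F) (y : bool -> A) (c : A) j := lin y j + ga j *: c.

(** The order of quantifiers is the point: [s] is chosen before the algebra, so a coefficient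
    detected in one algebra gives a relation in another. *)
Lemma weval_word_expand u : exists s : opcomb F,
  forall (A : walgType F) (C : A -> Prop), split_ideal chl chr C ->
  forall y c, C c ->
  weval_word (pt y c) u = weval_word (lin y) u + opcomb_eval y s c.
Proof.
case: u => [[[w0 i] t] w1].
pose M (A : walgType F) (b : nat -> A) t := foldl (fun m p => m ** (p.1 *> p.2))
  (wb F w0 *> b i) [seq (wb F p.1, b p.2) | p <- t].
(* [s1] is the linear part in [c] of a partial product, and [s0] is left multiplication on C by its
   unperturbed value. When the next letter contributes its own [c], the term added to [s1] comes
   from [s0]. *)
have [s0 [s1 sP]] : exists s0 s1 : opcomb F,
    forall (A : walgType F) (C : A -> Prop), split_ideal chl chr C -> forall y,
      (forall c, C c -> M A (pt y c) t = M A (lin y) t + opcomb_eval y s1 c)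
      /\ (forall d, C d -> M A (lin y) t ** d = opcomb_eval y s0 d).
  elim/last_ind: t => [|t [w j] [s0 [s1 IH]]].
    exists [:: (chl (wb F w0) * al i, [:: (true, true)]);
               (chl (wb F w0) * be i, [:: (true, false)])].
    exists [:: (chl (wb F w0) * ga i, [::])] => A C sC y; split=> [c Cc|d Cd].
      rewrite /opcomb_eval big_seq1 /M /= (islinearD (lact_linr _)).
      by rewrite (islinearZ (lact_linr _)) (split_lact sC _ Cc) scalerA mulrC.
    rewrite /opcomb_eval !big_cons big_nil addr0 /M /= /opword /=.
    rewrite -lact_mul (split_lact sC); last exact: (split_mull sC).
    by rewrite wmulDl !wmulZl scalerDr !scalerA.
  pose sc a (s : opcomb F) := [seq (a * q.1, q.2) | q <- s].
  exists (sc (chl (wb F w) * al j) [seq (q.1, rcons q.2 (true, true)) | q <- s0]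
       ++ sc (chl (wb F w) * be j) [seq (q.1, rcons q.2 (true, false)) | q <- s0]).
  exists ((sc (chr (wb F w) * al j) [seq (q.1, (false, true) :: q.2) | q <- s1]
       ++ sc (chr (wb F w) * be j) [seq (q.1, (false, false) :: q.2) | q <- s1])
       ++ sc (chl (wb F w) * ga j) s0).
  move=> A C sC y; have [IH1 IH0] := IH A C sC y.
  have Mr b : M A b (rcons t (w, j)) = M A b t ** (wb F w *> b j).
    by rewrite /M map_rcons -cats1 foldl_cat.
  split=> [c Cc|d Cd]; rewrite Mr.
    have Ce := split_opcomb y s1 sC Cc.
    rewrite IH1 // Mr !opcomb_cat !opcomb_scale !opcomb_cons -(IH0 c Cc) /=.
    move: (opcomb_eval y s1 c) Ce => e Ce.
    rewrite wmulDl {1}/pt (islinearD (lact_linr _)) (islinearZ (lact_linr _)).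
    rewrite (split_lact sC _ Cc) !wmulDr !wmulZr -!addrA; congr (_ + _).
    rewrite (split_sq sC Ce Cc) !scaler0 addr0 addrC scalerA mulrC addrA; congr (_ + _).
    rewrite -mul_ract_lact (split_ract sC _ Ce) wmulZl /lin wmulDr !wmulZr.
    by rewrite scalerDr !scalerA.
  rewrite opcomb_cat !opcomb_scale !opcomb_rcons /=.
  rewrite -wmulA -lact_mul (split_lact sC); last exact: (split_mull sC).
  rewrite wmulZr IH0; last exact: (split_mull sC).
  rewrite /lin wmulDl !wmulZl (islinearD (opcomb_linear _ _)).
  by rewrite !(islinearZ (opcomb_linear _ _)) scalerDr !scalerA.
exists [seq (chr (wb F w1) * q.1, q.2) | q <- s1] => A C sC y c Cc.
have [E _] := sP A C sC y.
rewrite /weval_word /wprod /= -!/(M A _ _) E // (islinearD (ract_linl _)).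
by rewrite opcomb_scale (split_ract sC _ (split_opcomb y s1 sC Cc)).
Qed.

Lemma weval_expand (f : freeW F) : exists s : opcomb F,
  forall (A : walgType F) (C : A -> Prop), split_ideal chl chr C ->
  forall y c, C c -> weval (pt y c) f = weval (lin y) f + opcomb_eval y s c.
Proof.
rewrite /weval /lext; elim: (enum_fset (msupp f)) => [|u r [s IH]].
  by exists [::] => A C sC y c Cc; rewrite /opcomb_eval !big_nil addr0.
have [s' sP] := weval_word_expand u.
exists ([seq (f@_u * q.1, q.2) | q <- s'] ++ s) => A C sC y c Cc.
rewrite !big_cons opcomb_cat opcomb_scale (IH _ _ sC) // (sP _ _ sC) //.
by rewrite scalerDr addrACA.
Qed.

End Expansion.

Section Relation.
Variables (F : fieldType) (A : walgType F) (chl chr : UT2 F -> F) (C : A -> Prop).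
Hypothesis charF : [pchar F] =i pred0.
Hypothesis sC : split_ideal chl chr C.
Implicit Types (s : opcomb F) (y : bool -> A) (c : A) (t : seq (bool * bool)).

Definition wletters (P K Q : seq A) : seq (option bool * A) :=
  [seq (Some true, x) | x <- P] ++ [seq (None, x) | x <- K]
  ++ [seq (Some false, x) | x <- Q].

Definition degree_in (w : bool) t : nat :=
  (count_mem (true, w) t + count_mem (false, w) t)%N.

Lemma opword_scale y (a : bool -> F) t c :
  opword (fun w => a w *: y w) t c =
  (a true ^+ degree_in true t * a false ^+ degree_in false t) *: opword y t c.
Proof.
rewrite /degree_in; elim: t => [|[b w] t IH]; first by rewrite mulr1 scale1r.
have opc z : opword z ((b, w) :: t) c = wop (Some b) (z w) (opword z t c) by [].
rewrite !opc {}IH (islinearZ (wop_linr (Some b) _)).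
rewrite (islinearZ (wop_linl (Some b) _)) scalerA {opc}; congr (_ *: _).
by case: b w => [] []; rewrite /= ?exprD ?exprS; ring.
Qed.

(** This order presents the word as a term of a [biform] in [y true], led by left multiplications,
    whose coefficient is a term of a [biform] in [y false], led by right ones. *)
Lemma opword_normal y t c : C c ->
  opword y t c =
  wops (nseq (count_mem (true, true) t) (Some true, y true)
     ++ nseq (count_mem (false, true) t) (Some false, y true))
    (wops (nseq (count_mem (false, false) t) (Some false, y false)
     ++ nseq (count_mem (true, false) t) (Some true, y false)) c).
Proof.
move=> Cc; rewrite -wops_cat /opword.
pose f (q : bool * bool) := (Some q.1, y q.2).
pose r := nseq (count_mem (true, true) t) (true, true)
  ++ nseq (count_mem (false, true) t) (false, true)
  ++ nseq (count_mem (false, false) t) (false, false)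
  ++ nseq (count_mem (true, false) t) (true, false).
have tr : perm_eq t r.
  by apply/allP => -[[] []] _ /=; rewrite !count_cat !count_nseq /=
    ?mul0n ?mul1n ?add0n ?addn0.
by rewrite (wops_perm sC Cc (perm_map f tr)) /r !map_cat !map_nseq -catA.
Qed.

(** Scaling [y true] by a and [y false] by b and extracting coefficients in both scalars isolates
    the component of bidegree (p, q). *)
Lemma opcomb_homogeneous s p q y c :
  (forall y, opcomb_eval y s c = 0) ->
  opcomb_eval y
    [seq u <- s | (degree_in true u.2 == p) && (degree_in false u.2 == q)] c = 0.
Proof.
move=> s0; rewrite /opcomb_eval big_filter -big_filter_cond.
apply: (coef_extract (d := fun u => degree_in false u.2) charF) => b.
rewrite big_filter.
under eq_bigr => u _ do rewrite scalerA mulrC -scalerA.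
pose v (u : F * seq (bool * bool)) := u.1 *: (b ^+ degree_in false u.2 *: opword y u.2 c).
apply: (coef_extract (d := fun u => degree_in true u.2) (v := v) charF) => a.
rewrite -[RHS](s0 (fun w => (if w then a else b) *: y w)).
apply: eq_bigr => u _; rewrite opword_scale /v !scalerA; congr (_ *: _); ring.
Qed.

(** [biform_elim] is applied in [y true], with coefficients that are forms in [y false], and then in
    [y false]. Each application retains the top coefficient, which leaves the scalar attached to L^p
    in [y true] times R^q in [y false]. *)
Lemma opcomb_elim s p q c xs vs xs' vs' : C c ->
  (forall y, opcomb_eval y s c = 0) ->
  size xs = p -> size vs = p -> size xs' = q -> size vs' = q ->
  (\sum_(u <- s | [&& count_mem (true, false) u.2 == 0,
      count_mem (false, true) u.2 == 0, count_mem (true, true) u.2 == p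
      & count_mem (false, false) u.2 == q]%N) u.1) *:
  wops ([seq (None, v) | v <- vs'] ++ [seq (Some false, x) | x <- xs'])
   (wops ([seq (None, v) | v <- vs] ++ [seq (Some true, x) | x <- xs]) c) = 0.
Proof.
move=> Cc s0 sxs svs sxs' svs'.
pose r := [seq u <- s | (degree_in true u.2 == p) && (degree_in false u.2 == q)].
have rd : all (fun u => (degree_in true u.2 == p) && (degree_in false u.2 == q)) r.
  exact: filter_all.
have rtt : all (fun u => count_mem (true, true) u.2 < p.+1)%N r.
  by apply: sub_all rd => u /andP[/eqP <- _]; rewrite ltnS leq_addr.
have rff : all (fun u => count_mem (false, false) u.2 < q.+1)%N r.
  by apply: sub_all rd => u /andP[_ /eqP <-]; rewrite ltnS leq_addl.
pose O := [seq (None, v) | v <- vs] ++ [seq (Some true, x) | x <- xs].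
pose m x i := \sum_(u <- r | count_mem (true, true) u.2 == i)
  u.1 *: wops (nseq (count_mem (false, false) u.2) (Some false, x)
     ++ nseq (q - count_mem (false, false) u.2) (Some true, x)) c.
have Cm x i : C (m x i).
  rewrite /m -big_filter; apply: (subspace_sum (split_sub sC)) => u.
  by apply: (subspaceZ (split_sub sC)); apply: (split_wops sC).
have m0 x x' : biform true p x (m x') = 0.
  rewrite -[RHS](opcomb_homogeneous p q (fun w => if w then x else x') s0) -/r.
  rewrite /opcomb_eval -(sum_fibers predT _ rtt); apply: eq_bigr => i _.
  rewrite (islinear_sum (wops_linear _)) -big_filter -[RHS]big_filter.
  apply: eq_big_seq => u; rewrite mem_filter => /andP[/eqP <- /(allP rd)].
  rewrite /degree_in => /andP[/eqP <- /eqP <-].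
  by rewrite opword_normal // (islinearZ (wops_linear _)) !addKn addnK.
have Om x : wops O (m x p) = 0.
  exact: (biform_elim charF sC (Cm x) (m0^~ x) sxs svs).
have CO : C (wops O c) by apply: (split_wops sC).
(* Moving the operators [O] inside makes [Om] a form in the second element whose coefficients are
   scalar multiples of [wops O c]. *)
pose m' j := (\sum_(u <- r | (count_mem (true, true) u.2 == p)
    && (count_mem (false, false) u.2 == j)) u.1) *: wops O c.
have m'0 x : biform false q x m' = 0.
  rewrite -[RHS](Om x) /m (islinear_sum (wops_linear _)).
  rewrite -(sum_fibers _ _ rff); apply: eq_bigr => j _.
  rewrite (islinearZ (wops_linear _)) scaler_suml; apply: eq_bigr => u /andP[_ /eqP <-].
  rewrite (islinearZ (wops_linear _)) -!wops_cat; congr (_ *: _).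
  by apply: (wops_perm sC) => //; rewrite perm_catC.
have := biform_elim charF sC (m := m') _ m'0 sxs' svs'.
rewrite /m' (islinearZ (wops_linear _)) => h; rewrite -[RHS]h; last first.
  by move=> i; apply: (subspaceZ (split_sub sC)).
congr (_ *: _); rewrite big_filter_cond; apply: eq_bigl => u.
rewrite /degree_in.
case: (count_mem (true, true) u.2 =P p) => [->|]; rewrite ?andbF //=.
case: (count_mem (false, false) u.2 =P q) => [->|]; rewrite ?andbF //= !andbT.
rewrite andbC -[X in (_ + _ == X)%N]addn0 eqn_add2l.
by rewrite -[X in (_ + _ == X)%N]add0n eqn_add2r.
Qed.

(** The elimination consumes p letters L, q letters R and p + q letters D; the remaining letters are
    commuting operators applied to 0. The common bound p + q makes the relation depend on a single
    number. *)
Lemma opcomb_relation s p q : (forall y c, C c -> opcomb_eval y s c = 0) ->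
  \sum_(u <- s | [&& count_mem (true, false) u.2 == 0,
      count_mem (false, true) u.2 == 0, count_mem (true, true) u.2 == p
      & count_mem (false, false) u.2 == q]%N) u.1 != 0 ->
  forall P K Q c, C c -> (p + q <= size P)%N -> (p + q <= size K)%N ->
    (p + q <= size Q)%N -> wops (wletters P K Q) c = 0.
Proof.
move=> s0 a0 P K Q c Cc lP lK lQ.
have sz (X : seq A) i j : (i + j <= size X)%N -> size (take j (drop i X)) = j.
  move=> lX; rewrite size_takel // size_drop leq_subRL //.
  exact: leq_trans (leq_addr _ _) lX.
have sK : size (take p K) = p by rewrite size_takel // (leq_trans (leq_addr _ _) lK).
have sK' := sz K p q lK.
have sP : size (take p P) = p by rewrite size_takel // (leq_trans (leq_addr _ _) lP).
have sQ : size (take q Q) = q by rewrite size_takel // (leq_trans (leq_addl _ _) lQ).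
have /eqP := opcomb_elim Cc (fun y => s0 y c Cc) sP sK sQ sK'.
rewrite scaler_eq0 (negPf a0) /= => /eqP; rewrite -wops_cat.
set l := (_ ++ _) => l0.
pose l' := wletters (drop p P) (drop q (drop p K)) (drop q Q).
rewrite -[RHS](linear0P (wops_linear l')) -l0 -wops_cat; apply: (wops_perm sC) => //.
rewrite /wletters -{1}(cat_take_drop p P) -{1}(cat_take_drop p K).
rewrite -{1}(cat_take_drop q (drop p K)) -{1}(cat_take_drop q Q) !map_cat.
rewrite /l' /l /wletters.
apply/seq.permP => a; rewrite !count_cat; ring.
Qed.

End Relation.

(** * Relations from a non-identity *)

Lemma eq_weval (F : fieldType) (A : walgType F) (a b : nat -> A) f :
  a =1 b -> weval a f = weval b f.
Proof.
move=> ab; apply: eq_bigr => u _; congr (_ *: wprod _ _).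
by apply: eq_map => p; rewrite ab.
Qed.

(** Common interface of [UT2F] and [UT2D]. By the last two fields coefficients preserve diagonal
    matrices, so that entry (1,2) of an evaluation sees only the part of the expansion along e12. *)
Record ut2_form (F : fieldType) (A : walgType F) (phi : A -> UT2 F)
    (psi : UT2 F -> A) : Prop := UT2Form {
  ut2f_lin : linear phi;
  ut2f_K : cancel phi psi;
  ut2f_VK : cancel psi phi;
  ut2f_mul : forall x y, phi (x ** y) = phi x * phi y;
  ut2f_lact : forall w x, ut2val (phi x) 0 1 = 0 -> ut2val (phi (w *> x)) 0 1 = 0;
  ut2f_ract : forall x w, ut2val (phi x) 0 1 = 0 -> ut2val (phi (x <* w)) 0 1 = 0
}.

Section UT2Form.
Variables (F : fieldType) (A : walgType F) (phi : A -> UT2 F) (psi : UT2 F -> A).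
Hypothesis fA : ut2_form phi psi.

Let inj_phi : injective phi := can_inj (ut2f_K fA).

Definition ut2unit (b : bool) : A := psi (if b then 1 - e22 F else e22 F).

Lemma ut2f_entryZD a (x y : A) i j : ut2val (phi (a *: x + y)) i j =
  a * ut2val (phi x) i j + ut2val (phi y) i j.
Proof. by rewrite (ut2f_lin fA) /= !mxE. Qed.

Lemma ut2_wop b w :
  wop (Some b) (ut2unit w) (psi (e12 F)) = (b == w)%:R *: psi (e12 F).
Proof.
apply: inj_phi; rewrite (islinearZ (ut2f_lin fA)) (ut2f_VK fA).
case: b; rewrite /= (ut2f_mul fA) !(ut2f_VK fA); case: w; apply: UT2P;
  by rewrite !UT2_entryM /= !mxE /=
    ?(mulr0, mul0r, mulr1, mul1r, addr0, add0r, subr0, subrr, oppr0).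
Qed.

Lemma ut2_opword t :
  opword ut2unit t (psi (e12 F)) = (all (fun q => q.1 == q.2) t)%:R *: psi (e12 F).
Proof.
elim: t => [|q t IH]; first by rewrite scale1r.
transitivity (wop (Some q.1) (ut2unit q.2) (opword ut2unit t (psi (e12 F)))) => //.
rewrite IH (islinearZ (wop_linr _ _)) ut2_wop scalerA -natrM mulnb /=.
by rewrite andbC.
Qed.

Lemma ut2_e12_neq0 : psi (e12 F) != 0.
Proof.
apply/eqP => /(congr1 phi); rewrite (ut2f_VK fA) (linear0P (ut2f_lin fA)).
by move=> /(congr1 (fun w => ut2val w 0 1)) /eqP; rewrite /= !mxE /= oner_eq0.
Qed.

Lemma nonidentity_e12 (I : freeW F -> Prop) f :
  (forall g, I g -> I (weval (fun i => wvar F i.+1) g ** wvar F 0)) ->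
  (forall g, I g -> I (wvar F 0 ** weval (fun i => wvar F i.+1) g)) ->
  I f -> ~ GId A f ->
  exists g a, I g /\ ut2val (phi (weval a g)) 0 1 <> 0.
Proof.
move=> Ir Il If nf; apply: NNPP => nex; apply: nf => a.
have e0 g b : I g -> ut2val (phi (weval b g)) 0 1 = 0.
  by move=> Ig; apply: NNPP => ne; apply: nex; exists g, b.
pose b i := if i is j.+1 then a j else psi (e12 F).
have bS : weval b (weval (fun i => wvar F i.+1) f) = weval a f.
  by rewrite weval_sub; apply: eq_weval => i; rewrite weval_var.
have := e0 _ b (Il _ If); have := e0 _ b (Ir _ If); have := e0 _ a If.
rewrite weval_mul weval_mul bS weval_var /= !(ut2f_mul fA) (ut2f_VK fA) => h1 h2 h3.
apply: inj_phi; rewrite (linear0P (ut2f_lin fA)); move: h1 h2 h3.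
rewrite !UT2_entryM /= !mxE /= !(mulr0, mul0r, mulr1, mul1r, addr0, add0r) => h1 h2 h3.
by apply: UT2P; rewrite ?h1 ?h2 ?h3 /= !mxE.
Qed.

Lemma weval_diag (a : nat -> A) f : (forall i, ut2val (phi (a i)) 0 1 = 0) ->
  ut2val (phi (weval a f)) 0 1 = 0.
Proof.
apply: (weval_closed (C := fun x => ut2val (phi x) 0 1 = 0)).
- split=> [|c u v hu hv]; last by rewrite ut2f_entryZD hu hv mulr0 addr0.
  by rewrite (linear0P (ut2f_lin fA)) /= mxE.
- by move=> x y hx hy; rewrite (ut2f_mul fA) UT2_entryM hx hy mulr0 mul0r addr0.
- exact: (ut2f_lact fA).
- exact: (ut2f_ract fA).
Qed.

(* A non-identity of [A] holding in all algebras of [U] can be evaluated in [A]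
   with nonzero entry (1,2); its first-order expansion along e12 then has a
   nonzero coefficient on a word multiplying only by e11 on the left and by e22
   on the right, and the expansion is a relation in the algebras of [U]. *)
Lemma nonidentity_relation (chl chr : UT2 F -> F)
    (CC : forall B : walgType F, B -> Prop) (U : wclass F) f :
  [pchar F] =i pred0 ->
  (forall B, gvar A B -> split_ideal chl chr (CC B)) -> CC A (psi (e12 F)) ->
  subclass U (gvar A) -> GIdV U f -> ~ GId A f ->
  exists m, forall B, U B -> forall P K Q c, CC B c ->
    (m <= size P)%N -> (m <= size K)%N -> (m <= size Q)%N ->
    wops (wletters P K Q) c = 0.
Proof.
move=> charF sC C12 UA Uf nf.
have [g [a [Ug na]]] : exists g a, GIdV U g /\ ut2val (phi (weval a g)) 0 1 <> 0.
  apply: nonidentity_e12 nf => // g Ug B UB b.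
    by rewrite weval_mul weval_sub Ug // wmul0l.
  by rewrite weval_mul weval_sub Ug // wmul0r.
pose al j := ut2val (phi (a j)) 0 0; pose be j := ut2val (phi (a j)) 1 1.
pose ga j := ut2val (phi (a j)) 0 1.
have [s sP] := weval_expand chl chr al be ga g.
pose good (u : F * seq (bool * bool)) := all (fun q => q.1 == q.2) u.2.
have s0 : \sum_(u <- s | good u) u.1 != 0.
  apply/eqP => s0; apply: na.
  (* In the basis e11, e22, e12 each [a j] has the form required by [weval_expand], with y at the
     idempotents and c at e12. *)
  have -> : weval a g = weval (fun j => (al j *: ut2unit true + be j *: ut2unit false)
      + ga j *: psi (e12 F)) g.
    apply: eq_weval => j; apply: inj_phi.
    rewrite !(islinearD (ut2f_lin fA)) !(islinearZ (ut2f_lin fA)) !(ut2f_VK fA).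
    apply: UT2P; rewrite /= !mxE /=;
      by rewrite ?(mulr0, mulr1, addr0, add0r, subr0, subrr, oppr0).
  have gA : gvar A A by move=> h; apply.
  rewrite (sP A (CC A) (sC A gA) ut2unit) //.
  rewrite (islinearD (ut2f_lin fA)) /= mxE weval_diag; last first.
    move=> i; rewrite (islinearD (ut2f_lin fA)) !(islinearZ (ut2f_lin fA)) !(ut2f_VK fA).
    by rewrite /= !mxE /= subrr !mulr0 addr0.
  have -> : opcomb_eval ut2unit s (psi (e12 F)) = 0.
    transitivity ((\sum_(u <- s | good u) u.1) *: psi (e12 F)); last first.
      by rewrite s0 scale0r.
    rewrite scaler_suml [RHS]big_mkcond; apply: eq_bigr => u _.
    rewrite ut2_opword /good; case: (all _ _); first by rewrite scale1r.
    by rewrite scale0r scaler0.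
  by rewrite (linear0P (ut2f_lin fA)) /= mxE addr0.
pose n (l : bool * bool) (u : F * seq (bool * bool)) := count_mem l u.2.
have goodE u : good u = (n (true, false) u == 0%N) && (n (false, true) u == 0%N).
  rewrite /good /n; elim: (u.2) => //= -[b w] t ->.
  by case: b w => [] [] //=; rewrite andbF.
(* The nonzero sum over good words splits into finitely many sums according to the numbers of left
   and right letters, so one of these is nonzero. *)
have [p [q apq]] : exists p q, \sum_(u <- s | [&& n (true, false) u == 0,
    n (false, true) u == 0, n (true, true) u == p & n (false, false) u == q]%N) u.1 != 0.
  apply: NNPP => nex; case/eqP: s0.
  have bnd l : exists N, all (fun u => n l u < N)%N s.
    elim: (s) => [|u r [N IH]]; first by exists 0%N.
    exists (maxn (n l u).+1 N); rewrite /= leq_maxl /=.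
    by apply: sub_all IH => v /leq_trans; apply; rewrite leq_maxr.
  have [N1 N1P] := bnd (true, true); have [N2 N2P] := bnd (false, false).
  rewrite -(sum_fibers _ _ N1P) big1 // => p _.
  rewrite -(sum_fibers _ _ N2P) big1 // => q _.
  apply/eqP; apply: contraT => ne; case: nex.
  exists (p : nat), (q : nat); congr (_ != 0): ne; apply: eq_bigl => u.
  by rewrite goodE -!andbA.
exists (p + q)%N => B UB P K Q c Cc.
have sB := sC B (UA B UB).
apply: (opcomb_relation charF sB _ apq) => // y d Cd.
(* Both evaluations of [g] vanish in [B], hence so does the linear part. *)
have := sP B (CC B) sB y d Cd; rewrite !Ug // => h.
by rewrite -[LHS]add0r -h.
Qed.

End UT2Form.

(** * Exponential lower bound *)

Section CodimensionBounds.
Variables (F : fieldType) (I : freeW F -> Prop) (n : nat).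
Variables (T : finType) (g : T -> freeW F).
Hypothesis sI : subspace I.

Let sum_enum_val (c : T -> F) :
  \sum_(t : T) c t *: g t = \sum_(i < #|T|) c (enum_val i) *: g (enum_val i).
Proof.
rewrite (reindex_onto enum_rank enum_val) => [|i _]; last by rewrite enum_valK.
rewrite (eq_bigl predT) => [|t]; last by rewrite enum_rankK eqxx.
by apply: eq_bigr => t _; rewrite enum_rankK.
Qed.

Lemma gcodim_le :
  (forall f, GP n f -> exists c : T -> F, I (f - \sum_t c t *: g t)) ->
  (gcodim I n <= #|T|)%N.
Proof.
move=> span; have [e [Ue fe _]] := gcodimP n sI.
apply: (steinitz_mod (g := fun i : 'I_#|T| => g (enum_val i)) sI fe) => i.
have [c Ic] := span _ (Ue i).
by exists (fun i => c (enum_val i)); rewrite -sum_enum_val.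
Qed.

Lemma gcodim_ge : (forall t, GP n (g t)) ->
  (forall c : T -> F, I (\sum_t c t *: g t) -> forall t, c t = 0) ->
  (#|T| <= gcodim I n)%N.
Proof.
move=> Ug fg; have [e [_ _ se]] := gcodimP n sI.
apply: (steinitz_mod (e := fun i : 'I_#|T| => g (enum_val i)) (g := e) sI) => [c Ic i|i].
  rewrite -[i]enum_valK; apply: (fg (fun t => c (enum_rank t))).
  by rewrite sum_enum_val; under eq_bigr => j _ do rewrite enum_valK.
exact: se.
Qed.

End CodimensionBounds.

Section Multilinear.
Variable F : fieldType.

Lemma gmultilinear_GP n (s : 'S_n) (w : nat -> UT2 F) : GP n (gmultilinear s w).
Proof.
exists 1%N, (fun _ => 1), (fun _ => s), (fun _ => w).
by rewrite big_ord1 scale1r.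
Qed.

Lemma perm_eq_map_perm n (s : 'S_n) : perm_eq [seq s i | i <- enum 'I_n] (enum 'I_n).
Proof.
apply: uniq_perm; rewrite ?enum_uniq ?(map_inj_uniq perm_inj) ?enum_uniq //.
move=> i; rewrite mem_enum; apply/mapP; exists (s^-1 i)%g; rewrite ?mem_enum //.
by rewrite permKV.
Qed.

Lemma perm_eq_enum_ord n (l : seq 'I_n) : perm_eq l (enum 'I_n) ->
  exists s : 'S_n, [seq s i | i <- enum 'I_n] = l.
Proof.
rewrite -val_ord_tuple => /tuple_permP[s ->]; exists s; rewrite val_ord_tuple.
by apply: eq_map => i; rewrite tnth_ord_tuple.
Qed.

Lemma wprod_ones (A : walgType F) (T : Type) (r : seq T) (x : T -> A) :
  wprod [seq (1, x i) | i <- r] 1 = wseqprod [seq x i | i <- r].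
Proof.
case: r => //= h t; rewrite /wprod /= ract1 lact1.
by elim: t (x h) => //= j t IH m; rewrite IH lact1.
Qed.

Lemma weval_gmultilinear (A : walgType F) (a : nat -> A) n (s : 'S_n) w :
  weval a (gmultilinear s w) =
  wprod [seq (w (val i), a (s i)) | i <- enum 'I_n] (w n).
Proof.
rewrite weval_wprod -map_comp; congr wprod; apply: eq_map => i.
by rewrite /= weval_var.
Qed.

End Multilinear.

Section LowerBound.
Variables (F : fieldType) (A : walgType F) (phi : A -> UT2 F) (psi : UT2 F -> A).
Hypothesis fA : ut2_form phi psi.

(* The words x_I x_n x_J, with {I, J} a partition of the other indices, are
   separated by the evaluations of x_n at e12 and of the other variables at e11
   or e22. *)
Lemma gcodim_ut2_ge n : (2 ^ n <= gcodim (GId A) n.+1)%N.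
Proof.
pose lst (X : {set 'I_n}) : seq 'I_n.+1 := [seq lift ord_max i | i <- enum X] ++
  ord_max :: [seq lift ord_max i | i <- enum (~: X)].
have lstP X : perm_eq (lst X) (enum 'I_n.+1).
  apply: uniq_perm; rewrite ?enum_uniq //.
    rewrite cat_uniq /= !(map_inj_uniq lift_inj) !enum_uniq /= andbT.
    apply/andP; split; last by apply/mapP => -[i _ /eqP]; rewrite eq_liftF.
    rewrite negb_or; apply/andP; split.
      by apply/mapP => -[i _ /eqP]; rewrite eq_liftF.
    apply/hasPn => _ /mapP[i Xi ->]; apply/mapP => -[j Xj /lift_inj ij].
    by move: Xi Xj; rewrite !mem_enum inE ij => /negPf ->.
  move=> i; rewrite mem_enum inE mem_cat inE.
  case: (unliftP ord_max i) => [j|] ->; last by rewrite eqxx orbT.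
  by rewrite !(mem_map lift_inj) !mem_enum in_setC; case: (j \in X) => //=; rewrite orbT.
pose sgs X := constructive_indefinite_description _ (perm_eq_enum_ord (lstP X)).
pose sg X := proj1_sig (sgs X).
have sgP X : [seq sg X i | i <- enum 'I_n.+1] = lst X by exact: proj2_sig (sgs X).
pose g X := gmultilinear (sg X) (fun _ => 1 : UT2 F).
have <- : #|{set 'I_n}| = (2 ^ n)%N.
  by rewrite -cardsT -powersetT card_powerset cardsT card_ord.
apply: (gcodim_ge (g := g) (GId_subspace A)) => [X|c Ic Y]; first exact: gmultilinear_GP.
pose a (i : nat) : A := if insub i is Some j then ut2unit psi (j \in Y) else psi (e12 F).
have al (j : 'I_n) : a (lift ord_max j) = ut2unit psi (j \in Y).
  by rewrite /a lift_max valK.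
have am : a (ord_max : 'I_n.+1) = psi (e12 F).
  by rewrite /a insubF //= ltnn.
have ga X : weval a (g X) = (X == Y)%:R *: psi (e12 F).
  rewrite weval_gmultilinear wprod_ones.
  have -> : [seq a (sg X i) | i <- enum 'I_n.+1] = [seq a j | j : 'I_n.+1 <- lst X].
    by rewrite -sgP -[RHS]map_comp.
  rewrite map_cat /= am wseqprod_catE -!map_comp -map_rev.
  pose t := [seq (true, i \in Y) | i <- enum X]
    ++ [seq (false, i \in Y) | i <- rev (enum (~: X))].
  transitivity (opword (ut2unit psi) t (psi (e12 F))).
    rewrite /opword /t map_cat -!map_comp; congr wops; congr (_ ++ _);
      by apply: eq_map => i; rewrite /= al.
  (* A left letter survives on e12 only at e11 and a right letter only at e22, so the word survives
     exactly when X = Y. *)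
  rewrite (ut2_opword fA); congr ((nat_of_bool _)%:R *: _).
  rewrite /t all_cat !all_map; apply/andP/eqP => [[/allP h1 /allP h2]|->].
    apply/setP => i; case Xi: (i \in X).
      by apply/eqP; apply: h1; rewrite mem_enum.
    by apply/eqP; apply: h2; rewrite mem_rev mem_enum in_setC Xi.
  split; apply/allP => i; rewrite ?mem_rev mem_enum ?in_setC /=; first by move=> ->.
  by move=> /negPf ->.
have := Ic a.
rewrite (islinear_sum (weval_linear a)) (bigD1 Y) //= big1 => [|X /negPf XY].
  rewrite (islinearZ (weval_linear a)) ga eqxx scale1r addr0 => /eqP.
  by rewrite scaler_eq0 (negPf (ut2_e12_neq0 fA)) orbF => /eqP.
by rewrite (islinearZ (weval_linear a)) ga XY scale0r scaler0.
Qed.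

Lemma not_poly_growth_ut2 : ~ polynomial_growth (gvar A).
Proof.
case=> C [k Ck].
have lt_exp j : (C * (2 ^ j) ^ k < 2 ^ (2 ^ j).-1)%N -> False.
  move=> lt; have := Ck (2 ^ j)%N; rewrite expn_gt0 gc_gvar => /(_ isT) le.
  have := gcodim_ut2_ge (2 ^ j).-1; rewrite prednK ?expn_gt0 // => ge.
  by have := leq_ltn_trans (leq_trans ge le) lt; rewrite ltnn.
(* With j = 2m, C (2^j)^k is below 2^(C + 2mk). This [m] gives C + 2mk < m^2, and m^2 <= 2^(2m), so
   the exponent is at most 2^j - 1. *)
pose m := (C + k.*2).+3; apply: (lt_exp m.*2).
have lt_m : (m < 2 ^ m)%N by apply: ltn_expl.
apply: (@leq_trans (2 ^ C * (2 ^ m.*2) ^ k)).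
  by rewrite ltn_mul2r !expn_gt0 /= ltn_expl.
rewrite -expnM -expnD leq_exp2l // -ltnS prednK ?expn_gt0 //.
apply: (@leq_trans (m * m)); last first.
  by rewrite -addnn expnD; apply: leq_mul; apply: ltnW.
rewrite /m -!addnn; have := leq0n (C * C); have := leq0n (C * k); nia.
Qed.

End LowerBound.

(** * Polynomial upper bound *)

Section SpanMod.
Variables (F : fieldType) (V : lmodType F) (I : V -> Prop) (T : finType) (g : T -> V).
Hypothesis sI : subspace I.

Definition span_mod (f : V) : Prop := exists c : T -> F, I (f - \sum_t c t *: g t).

Lemma span_mod_ideal f : I f -> span_mod f.
Proof.
move=> If; exists (fun _ => 0); rewrite big1 ?subr0 // => t _.
by rewrite scale0r.
Qed.

Lemma span_mod_subspace : subspace span_mod.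
Proof.
split=> [|a u v [c cP] [d dP]]; first by apply: span_mod_ideal; case: sI.
exists (fun t => a * c t + d t); case: sI => _ /(_ a _ _ cP dP).
rewrite scalerBr addrACA -opprD scaler_sumr -big_split /=.
by under eq_bigr => t _ do rewrite scalerA -scalerDl.
Qed.

Lemma span_mod_gen t : span_mod (g t).
Proof.
exists (fun u => (u == t)%:R); rewrite (bigD1 t) //= eqxx scale1r big1 => [|u /negPf ->].
  by rewrite addr0 subrr; case: sI.
by rewrite scale0r.
Qed.

End SpanMod.

(** Unlike [wop_comm] this is mere associativity, valid for every [c]; it therefore applies in the
    free algebra too. *)
Lemma wop_wopsL (F : fieldType) (A : walgType F) (x c : A) (P : seq A) :
  wop (Some false) x (wops [seq (Some true, y) | y <- P] c) =
  wops [seq (Some true, y) | y <- P] (wop (Some false) x c).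
Proof.
elim: P => // y P IH; rewrite !map_cons !wops_cons -IH.
exact: esym (wmulA _ _ _).
Qed.

Section Spanning.
Variables (F : fieldType) (U : wclass F) (chl chr : UT2 F -> F).
Variables (CC : forall B : walgType F, B -> Prop) (m : nat).
Hypothesis sC : forall B, U B -> split_ideal chl chr (@CC B).
Hypothesis rel : forall B, U B -> forall P K Q c, @CC B c ->
    (m <= size P)%N -> (m <= size K)%N -> (m <= size Q)%N ->
    wops (wletters P K Q) c = 0.
(** [cc j] is the element on which operator words act and [us j] lists the variables it uses: a
    commutator of two variables for [UT2F], the component e11 x e22 of one variable for [UT2D]. *)
Variables (us : nat * nat -> seq nat) (cc : nat * nat -> freeW F).
Hypothesis CCcc : forall B, U B -> forall a j, @CC B (weval a (cc j)).

Definition wvars (P : seq nat) : seq (freeW F) := [seq wvar F i | i <- P].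

Definition wletter_vars P K Q := wletters (wvars P) (wvars K) (wvars Q).

Lemma weval_wletters (B : walgType F) (a : nat -> B) P K Q f :
  weval a (wops (wletter_vars P K Q) f) =
  wops (wletters (map a P) (map a K) (map a Q)) (weval a f).
Proof.
rewrite weval_wops /wletters !map_cat -!map_comp; congr wops.
by congr (_ ++ (_ ++ _)); apply: eq_map => i /=; rewrite weval_var.
Qed.

Variable n : nat.

(* Writing L_x = D_x + R_x, with D the difference operators, one letter at a time
   leaves at most m letters D before the relation applies, and only polynomially
   many words with at most m prescribed letters of all kinds but one. *)
Lemma span_wletters (S : freeW F -> Prop) j : subspace S ->
  (forall f, GIdV U f -> S f) ->
  (forall P K Q, (size P <= m)%N -> (size K <= m)%N ->
    perm_eq (P ++ K ++ Q ++ us j) (iota 0 n) -> S (wops (wletter_vars P K Q) (cc j))) ->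
  (forall P Q, (size Q <= m)%N -> perm_eq (P ++ Q ++ us j) (iota 0 n) ->
    S (wops (wletter_vars P [::] Q) (cc j))) ->
  forall P Q, perm_eq (P ++ Q ++ us j) (iota 0 n) ->
    S (wops (wletter_vars P [::] Q) (cc j)).
Proof.
move=> sS SI S1 S2 P Q pe.
have [szP|szP] := leqP (size P) m; first exact: S1.
have [szQ|szQ] := leqP (size Q) m; first exact: S2.
have sz1 : size (take m P) = m by rewrite size_takel // ltnW.
(* [P1] is a reserve of [m] letters L and [Q1] keeps at least [m] letters R, so the relation applies
   as soon as [K] has [m] letters; only the letters of [P2] are rewritten. *)
have step P1 P2 K Q1 : size P1 = m -> (m <= size Q1)%N ->
    perm_eq (P1 ++ K ++ P2 ++ Q1 ++ us j) (iota 0 n) ->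
    S (wops ([seq (Some true, x) | x <- wvars P1] ++ [seq (None, x) | x <- wvars K]
      ++ [seq (Some true, x) | x <- wvars P2]
      ++ [seq (Some false, x) | x <- wvars Q1]) (cc j)).
  move=> sP1; elim: P2 K Q1 => [|x P2 IH] K Q1 sQ1 pe1.
    have [szK|szK] := leqP (size K) m; first by apply: S1; rewrite ?sP1.
    apply: SI => B UB a; rewrite -[wops _ _]/(wops (wletter_vars P1 K Q1) _).
    rewrite weval_wletters.
    by apply: rel; rewrite ?size_map ?sP1 // ?(ltnW szK) //; apply: CCcc.
  have := subspaceD sS (IH (rcons K x) Q1 sQ1 _) (IH K (x :: Q1) (leqW sQ1) _).
  rewrite /wvars map_rcons map_rcons -!cats1 -/(wvars K) !map_cons !wops_cat !wops_cons.
  rewrite -(wop_wopsL (wvar F x)) -!(islinearD (wops_linear _)).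
  rewrite [wop None _]/wop subrK; apply.
    apply: perm_trans pe1; apply/seq.permP => a.
    by rewrite !count_cat /= ?count_cat /=; ring.
  apply: perm_trans pe1; apply/seq.permP => a.
  by rewrite !count_cat /= ?count_cat /=; ring.
rewrite /wletter_vars /wletters /wvars -{1}(cat_take_drop m P) !map_cat -catA.
by apply: (step _ _ [::]); rewrite // ?(ltnW szQ) //= catA cat_take_drop.
Qed.

Hypothesis n_gt0 : (0 < n)%N.

(** A list of at most [m] indices, as a length and a padded tuple. There are (m+1) n^m codes, which
    is the source of polynomial growth. *)
Definition wcode : Type := ('I_m.+1 * m.-tuple 'I_n)%type.
Definition wdecode (k : wcode) : seq nat := [seq val i | i <- take k.1 k.2].

Lemma wdecode_surj (s : seq nat) : (size s <= m)%N -> {subset s <= iota 0 n} ->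
  exists k, wdecode k = s.
Proof.
move=> ss sn; pose x0 := Ordinal n_gt0.
pose t := [seq insubd x0 i | i <- s] ++ nseq (m - size s) x0.
have st : size t == m by rewrite size_cat size_map size_nseq subnKC.
exists (inord (size s), Tuple st); rewrite /wdecode /= inordK ?ltnS //.
rewrite /t take_size_cat ?size_map // -map_comp -[RHS]map_id.
apply/eq_in_map => i /sn; rewrite mem_iota /= add0n => lt_in.
by rewrite /= val_insubd lt_in.
Qed.

(** By multilinearity the one long list of letters is the complement of the others; its order is
    irrelevant on the split ideal. *)
Definition wrest (P : seq nat) j : seq nat := [seq i <- iota 0 n | i \notin P ++ us j].

Lemma perm_wrest P Q j : perm_eq (P ++ Q ++ us j) (iota 0 n) -> perm_eq Q (wrest P j).
Proof.
move=> pe; rewrite perm_sym /wrest -(permPl (perm_filter _ pe)).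
have : uniq (P ++ Q ++ us j) by rewrite (perm_uniq pe) iota_uniq.
rewrite catA (perm_uniq (s2 := Q ++ (P ++ us j))); last first.
  by apply/seq.permP => a; rewrite !count_cat; ring.
rewrite cat_uniq => /and3P[_ /hasPn Qn _].
rewrite !filter_cat.
have f0 R : {subset R <= P ++ us j} -> [seq i <- R | i \notin P ++ us j] = [::].
  move=> sR; apply/eqP; rewrite -size_eq0 size_filter -leqn0 leqNgt -has_count.
  by apply/hasPn => i /sR ->.
rewrite (f0 P) ?(f0 (us j)) ?cats0 //; last 2 first.
- by move=> i iu; rewrite mem_cat iu orbT.
- by move=> i iu; rewrite mem_cat iu.
rewrite (_ : filter _ Q = Q) //; apply/all_filterP/allP => i iQ.
by apply/negP => /Qn; rewrite /= iQ.
Qed.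

(** The two shapes left by [span_wletters]: few letters L and D with R taking the rest, or few
    letters R with L taking the rest. *)
Definition wgen (t : bool * ('I_n * 'I_n) * wcode * wcode) : freeW F :=
  let: (b, (i, j), k, l) := t in
  if b then
    wops (wletter_vars (wdecode k) (wdecode l)
      (wrest (wdecode k ++ wdecode l) (val i, val j))) (cc (val i, val j))
  else wops (wletter_vars (wrest (wdecode k) (val i, val j)) [::] (wdecode k))
         (cc (val i, val j)).

Lemma wgen_span (S : freeW F -> Prop) : subspace S ->
  (forall f, GIdV U f -> S f) -> (forall t, S (wgen t)) ->
  forall j P Q, (j.1 < n)%N -> (j.2 < n)%N -> perm_eq (P ++ Q ++ us j) (iota 0 n) ->
    S (wops (wletter_vars P [::] Q) (cc j)).
Proof.
move=> sS SI Sg [i j] P Q /= ltin ltjn pe0.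
have Sperm P1 K1 Q1 P2 Q2 : perm_eq P1 P2 -> perm_eq Q1 Q2 ->
    S (wops (wletter_vars P1 K1 Q1) (cc (i, j))) ->
    S (wops (wletter_vars P2 K1 Q2) (cc (i, j))).
  move=> pP pQ SP; rewrite -[wops _ _](subrK (wops (wletter_vars P1 K1 Q1) (cc (i, j)))).
  apply: (subspaceD sS) SP; apply: SI => B UB a.
  rewrite (islinearB (weval_linear a)) !weval_wletters.
  apply/eqP; rewrite subr_eq0; apply/eqP.
  apply: (wops_perm (sC UB) (CCcc UB a _)).
  apply: perm_cat; first by apply/perm_map/perm_map; rewrite perm_sym.
  by apply: perm_cat => //; apply/perm_map/perm_map; rewrite perm_sym.
apply: (span_wletters sS SI) pe0 => {P Q} [P K Q sP sK|P Q sQ] pe.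
  have [x|k kE] := wdecode_surj sP; first by rewrite -(perm_mem pe) mem_cat => ->.
  have [x|l lE] := wdecode_surj sK.
    by rewrite -(perm_mem pe) !mem_cat => ->; rewrite orbT.
  have := Sg (true, (Ordinal ltin, Ordinal ltjn), k, l); rewrite /wgen kE lE /=.
  by apply: Sperm => //; rewrite perm_sym; apply: perm_wrest; rewrite -catA.
have [x|k kE] := wdecode_surj sQ.
  by rewrite -(perm_mem pe) !mem_cat => ->; rewrite orbT.
have := Sg (false, (Ordinal ltin, Ordinal ltjn), k, k); rewrite /wgen kE /=.
apply: Sperm => //; rewrite perm_sym; apply: perm_wrest.
by rewrite catA (perm_trans _ pe) // catA perm_cat2r perm_catC.
Qed.

End Spanning.

(** The last hypothesis quantifies over subspaces S, to be taken as the span of the generators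
    modulo identities, so explicit coefficients never appear. [ex n] holds two multilinear elements
    outside the family of operator words. *)
Lemma polynomial_growth_of_span (F : fieldType) (U : wclass F) (chl chr : UT2 F -> F)
    (CC : forall B : walgType F, B -> Prop) (m : nat)
    (us : nat * nat -> seq nat) (cc : nat * nat -> freeW F)
    (ex : nat -> bool -> freeW F) :
  (forall B, U B -> split_ideal chl chr (CC B)) ->
  (forall B, U B -> forall P K Q c, CC B c ->
    (m <= size P)%N -> (m <= size K)%N -> (m <= size Q)%N ->
    wops (wletters P K Q) c = 0) ->
  (forall B, U B -> forall a j, CC B (weval a (cc j))) ->
  (forall n (S : freeW F -> Prop), subspace S -> (forall f, GIdV U f -> S f) ->
    (forall b, S (ex n b)) ->
    (forall j P Q, (j.1 < n)%N -> (j.2 < n)%N -> perm_eq (P ++ Q ++ us j) (iota 0 n) ->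
      S (wops (wletter_vars F P [::] Q) (cc j))) ->
    forall (s : 'S_n) w, S (gmultilinear s w)) ->
  polynomial_growth U.
Proof.
(* The generators number 2 + 2 n^2 ((m+1) n^m)^2: two exceptional ones, then a shape, a pair of
   indices and two codes. *)
move=> sC rel CCcc red; exists (2 + 2 * m.+1 ^ 2)%N, (2 + m + m)%N => n n_gt0.
pose T := (bool + bool * ('I_n * 'I_n) * wcode m n * wcode m n)%type.
pose g (t : T) := match t with inl b => ex n b | inr u => wgen us cc u end.
have sI := GIdV_subspace U.
have cT : #|{: T}| = (2 + 2 * (n * n) * (m.+1 * n ^ m) * (m.+1 * n ^ m))%N.
  by rewrite card_sum !card_prod card_bool !card_ord card_tuple card_ord.
apply: leq_trans (_ : #|{: T}| <= _)%N.
  apply: (gcodim_le (g := g) sI) => f [d [c [s [w ->]]]].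
  have sS := span_mod_subspace g sI.
  apply: (subspace_sum sS) => k; apply: (subspaceZ sS).
  apply: (red n _ sS) => [h Uh|b|].
  - exact: (span_mod_ideal g).
  - exact: (span_mod_gen g sI (inl b)).
  apply: (wgen_span sC rel CCcc n_gt0 sS) => [h Uh|u].
  - exact: (span_mod_ideal g).
  - exact: (span_mod_gen g sI (inr u)).
rewrite cT mulnDl !expnD -mulnn; apply: leq_add.
  by rewrite leq_pmulr // !muln_gt0 !expn_gt0 n_gt0.
by apply: eq_leq; rewrite !expnS expn0; ring.
Qed.

Lemma proper_nonidentity (F : fieldType) (A : walgType F) (U : wclass F) :
  gvariety U -> ~ subclass (gvar A) U -> exists2 f, GIdV U f & ~ GId A f.
Proof.
case=> S [US SU] nAU; apply: NNPP => nex; apply: nAU => B AB; apply: SU => f Sf.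
apply: AB; apply: NNPP => nf; apply: nex; exists f => //.
by move=> B' UB'; apply: US.
Qed.

Lemma almost_polynomial_growth_ut2 (F : fieldType) (A : walgType F)
    (phi : A -> UT2 F) (psi : UT2 F -> A) (chl chr : UT2 F -> F)
    (CC : forall B : walgType F, B -> Prop)
    (us : nat * nat -> seq nat) (cc : nat * nat -> freeW F)
    (ex : nat -> bool -> freeW F) :
  [pchar F] =i pred0 -> ut2_form phi psi -> CC A (psi (e12 F)) ->
  (forall B, gvar A B -> split_ideal chl chr (CC B)) ->
  (forall B, gvar A B -> forall a j, CC B (weval a (cc j))) ->
  (forall n (I S : freeW F -> Prop), (forall f, GId A f -> I f) ->
    subspace S -> (forall f, I f -> S f) ->
    (forall b, S (ex n b)) ->
    (forall j P Q, (j.1 < n)%N -> (j.2 < n)%N -> perm_eq (P ++ Q ++ us j) (iota 0 n) ->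
      S (wops (wletter_vars F P [::] Q) (cc j))) ->
    forall (s : 'S_n) w, S (gmultilinear s w)) ->
  almost_polynomial_growth (gvar A).
Proof.
move=> charF fA C12 sC CCcc red; split; first exact: (not_poly_growth_ut2 fA).
move=> U gU UA nAU; have [f Uf nf] := proper_nonidentity gU nAU.
have [m rel] := nonidentity_relation fA charF sC C12 UA Uf nf.
apply: (polynomial_growth_of_span (us := us) (cc := cc) (ex := ex) _ rel).
- by move=> B /UA; apply: sC.
- by move=> B /UA UB a j; apply: CCcc.
- move=> n S sS SI; apply: (red n (GIdV U)) => // h Ah B /UA AB; exact: AB.
Qed.

(** * The two varieties *)

Lemma gvar_eq (F : fieldType) (A B : walgType F) (f g : freeW F) : gvar A B ->
  (forall a : nat -> A, weval a f = weval a g) ->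
  forall b : nat -> B, weval b f = weval b g.
Proof.
move=> AB fg b; apply/eqP; rewrite -subr_eq0 -(islinearB (weval_linear b)).
apply/eqP; apply: AB => a.
by rewrite (islinearB (weval_linear a)) fg subrr.
Qed.

Lemma weval_wcomm (F : fieldType) (A : walgType F) (a : nat -> A) f g :
  weval a (wcomm f g) = wcomm (weval a f) (weval a g).
Proof.
rewrite /wcomm (islinearB (weval_linear a)) (weval_mul a f g); congr (_ - _).
exact: weval_mul.
Qed.

Definition wcomm_var (F : fieldType) (i j : nat) : freeW F := wcomm (wvar F i) (wvar F j).

Lemma weval_wcomm_var (F : fieldType) (A : walgType F) (a : nat -> A) i j :
  weval a (wcomm_var F i j) = wcomm (a i) (a j).
Proof.
exact: etrans (weval_wcomm a _ _) (congr2 _ (weval_var a i) (weval_var a j)).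
Qed.

Lemma weval_wseqprod_vars (F : fieldType) (A : walgType F) (a : nat -> A) l :
  weval a (wseqprod (wvars F l)) = wseqprod [seq a i | i <- l].
Proof.
rewrite weval_wseqprod -map_comp; congr wseqprod; apply: eq_map => i.
exact: weval_var.
Qed.

Lemma wops_swap (F : fieldType) (A : walgType F) l (x y : A) :
  wops l (y ** x) = wops l (wcomm y x) + wops l (x ** y).
Proof. by rewrite -(islinearD (wops_linear _)) subrK. Qed.

Lemma wseqprod_vars2 (F : fieldType) s x y t :
  wseqprod (wvars F (s ++ x :: y :: t)) =
  wops (wletter_vars F s [::] (rev t)) (wvar F x ** wvar F y).
Proof.
rewrite /wletter_vars /wletters /wvars map_rev map_cat.
exact: wseqprod_cat2E.
Qed.

(** * The commutator ideal in the variety of [UT2F] *)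

Section UT2FVariety.
Variable F : fieldType.
Notation E := (UT2F F).

Let ch (w : UT2 F) : F := ut2val w 0 0.

(** No constructor mentions the coefficients: in this variety they act by scalars, so linear closure
    covers them. *)
Inductive comm_ideal (B : walgType F) : B -> Prop :=
| CommIdealComm x y : comm_ideal (wcomm x y)
| CommIdeal0 : comm_ideal 0
| CommIdealLin a x y : comm_ideal x -> comm_ideal y -> comm_ideal (a *: x + y)
| CommIdealMull x c : comm_ideal c -> comm_ideal (x ** c)
| CommIdealMulr c x : comm_ideal c -> comm_ideal (c ** x).

Lemma ut2F_form : ut2_form (A := E) id id.
Proof.
split=> // [w x|x w]; rewrite /= /lactF /ractF /= !mxE => ->;
  by rewrite !mulr0 !addr0.
Qed.

Lemma ut2F_lact (B : walgType F) w (b : B) : gvar E B -> w *> b = ch w *: b.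
Proof.
move=> EB; have := gvar_eq (f := w *> wvar F 0) (g := ch w *: wvar F 0) EB _ (fun _ => b).
rewrite weval_lact (islinearZ (weval_linear _)) weval_var; apply=> a.
rewrite weval_lact (islinearZ (weval_linear _)) weval_var.
by rewrite [LHS]/(lactF w (a 0%N)) /lactF !scaler0 !addr0.
Qed.

Lemma ut2F_ract (B : walgType F) w (b : B) : gvar E B -> b <* w = ch w *: b.
Proof.
move=> EB; have := gvar_eq (f := wvar F 0 <* w) (g := ch w *: wvar F 0) EB _ (fun _ => b).
rewrite weval_ract (islinearZ (weval_linear _)) weval_var; apply=> a.
rewrite weval_ract (islinearZ (weval_linear _)) weval_var.
by rewrite [LHS]/(ractF (a 0%N) w) /ractF !scaler0 !addr0.
Qed.

Lemma ut2_comm_diag (x y : UT2 F) i : ut2val (x * y - y * x) i i = 0.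
Proof.
have -> : i = 0 \/ i = 1 -> ut2val (x * y - y * x) i i = 0.
  by case=> ->; rewrite /= mxE [X in _ + X]mxE !UT2_entryM !UT2_10; ring.
- by [].
by case: i => [[|[|k]] hk] //; [left | right]; apply/val_inj.
Qed.

Lemma ut2F_commM (B : walgType F) (x y z t : B) : gvar E B -> wcomm x y ** wcomm z t = 0.
Proof.
move=> EB; pose b i := nth 0 [:: x; y; z; t] i.
pose f : freeW F := wcomm_var F 0 1 ** wcomm_var F 2 3.
have fE (A : walgType F) (a : nat -> A) :
    weval a f = wcomm (a 0%N) (a 1%N) ** wcomm (a 2) (a 3).
  exact: etrans (weval_mul _ _ _)
    (congr2 _ (weval_wcomm_var _ _ _) (weval_wcomm_var _ _ _)).
rewrite -[LHS](fE B b); apply: EB => a; rewrite fE.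
by apply: (UT2P (w := 0)); rewrite -[_ ** _]/((_ : UT2 F) * _) UT2_entryM !ut2_comm_diag
  ?UT2_10 !(mul0r, mulr0, addr0) /= mxE.
Qed.

Lemma ut2F_comm_mid (B : walgType F) (x y u z t : B) : gvar E B ->
  wcomm x y ** u ** wcomm z t = 0.
Proof.
move=> EB; pose b i := nth 0 [:: x; y; z; t; u] i.
pose f : freeW F := wcomm_var F 0 1 ** wvar F 4 ** wcomm_var F 2 3.
have fE (A : walgType F) (a : nat -> A) :
    weval a f = wcomm (a 0%N) (a 1%N) ** a 4 ** wcomm (a 2) (a 3).
  apply: etrans (weval_mul _ _ _) (congr2 _ _ (weval_wcomm_var _ _ _)).
  exact: etrans (weval_mul _ _ _) (congr2 _ (weval_wcomm_var _ _ _) (weval_var _ _)).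
rewrite -[LHS](fE B b); apply: EB => a; rewrite fE.
by apply: (UT2P (w := 0)); rewrite -[_ ** _]/((_ : UT2 F) * _ * _) !UT2_entryM !ut2_comm_diag
  ?UT2_10 !(mul0r, mulr0, addr0) /= mxE.
Qed.

(** Multiplying [c] on the right inserts a factor before the second commutator, hence the
    strengthening by a middle factor [u]. Without a unit the version lacking [u] must be stated
    separately. *)
Lemma comm_ideal_comm (B : walgType F) (c z t : B) : gvar E B -> comm_ideal c ->
  c ** wcomm z t = 0 /\ forall u, c ** u ** wcomm z t = 0.
Proof.
move=> EB; elim=> {c} [x y||a x y _ [hx hx'] _ [hy hy']|x c _ [h h']|c x _ [h h']].
- by split=> [|u]; [apply: ut2F_commM | apply: ut2F_comm_mid].
- by split=> [|u]; rewrite !wmul0l.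
- by split=> [|u]; rewrite !wmul_linl ?hx ?hy ?hx' ?hy' scaler0 addr0.
- split=> [|u]; first by rewrite -wmulA h wmul0r.
  by rewrite -[x ** c ** u]wmulA -wmulA h' wmul0r.
- by split=> [|u]; rewrite // -[c ** x ** u]wmulA.
Qed.

Lemma comm_ideal_sq (B : walgType F) (c d : B) : gvar E B ->
  comm_ideal c -> comm_ideal d -> c ** d = 0.
Proof.
move=> EB cI dI; suff : c ** d = 0 /\ forall u, c ** u ** d = 0 by case.
elim: dI => {d} [x y||a x y _ [hx hx'] _ [hy hy']|x d _ [h h']|d x _ [h h']].
- exact: comm_ideal_comm.
- by split=> [|u]; rewrite wmul0r.
- by split=> [|u]; rewrite !wmul_linr ?hx ?hy ?hx' ?hy' scaler0 addr0.
- by split=> [|u]; rewrite wmulA // -[c ** u ** x]wmulA.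
- by split=> [|u]; rewrite wmulA ?h ?h' wmul0l.
Qed.

Lemma comm_ideal_split (B : walgType F) : gvar E B -> split_ideal ch ch (@comm_ideal B).
Proof.
move=> EB; split=> *.
- by split=> [|a u v]; [exact: CommIdeal0 | exact: CommIdealLin].
- exact: CommIdealMull.
- exact: CommIdealMulr.
- exact: CommIdealComm.
- exact: comm_ideal_sq.
- exact: ut2F_lact.
- exact: ut2F_ract.
Qed.

Lemma ut2F_wprod (B : walgType F) (T : Type) (r : seq T) (w : T -> UT2 F) (x : T -> B) v :
  gvar E B -> wprod [seq (w i, x i) | i <- r] v =
  (\prod_(i <- r) ch (w i) * ch v) *: wseqprod [seq x i | i <- r].
Proof.
move=> EB; case: r => [|h t]; first by rewrite /wprod scaler0.
rewrite /wprod /= ut2F_ract // ut2F_lact // mulrC -scalerA; congr (_ *: _).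
rewrite big_cons; move: (ch (w h)) (x h) => k m; elim: t k m => [|i t IH] k m /=.
  by rewrite big_nil mulr1.
by rewrite ut2F_lact // wmulZl wmulZr scalerA IH big_cons mulrA.
Qed.

Lemma almost_polynomial_growth_ut2F : [pchar F] =i pred0 ->
  almost_polynomial_growth (gvar E).
Proof.
move=> charF; apply: (almost_polynomial_growth_ut2 (CC := comm_ideal)
  (us := fun j => [:: j.1; j.2]) (cc := fun j => wcomm_var F j.1 j.2)
  (ex := fun n _ => wseqprod (wvars F (iota 0 n))) charF ut2F_form _ comm_ideal_split).
- have e : wb F b12 * wb F b22 - wb F b22 * wb F b12 = wb F b12.
    by rewrite !wb_mul subr0.
  by rewrite -[X in comm_ideal X]e; exact: (CommIdealComm (e12 F : E) (e22 F)).
- by move=> B EB a j; rewrite weval_wcomm_var; exact: CommIdealComm.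
move=> n I S AI sS IS ex0 cc0 s w.
(* Monomials are sorted by adjacent swaps; each swap costs an operator word applied to a commutator,
   already in S. *)
have Sl l : perm_eq l (iota 0 n) -> S (wseqprod (wvars F l)).
  move=> pl; apply: (perm_swap_ind (P := fun l => perm_eq l (iota 0 n) ->
    S (wseqprod (wvars F l))) _ _ (fun _ => ex0 true) pl); last by rewrite perm_sym.
  move=> s1 x y t h pe.
  have pe' : perm_eq (s1 ++ x :: y :: t) (iota 0 n).
    apply: perm_trans pe; rewrite perm_cat2l.
    by apply/seq.permP => a /=; ring.
  have [ltx lty] : (x < n)%N /\ (y < n)%N.
    have sub i : i \in s1 ++ x :: y :: t -> (i < n)%N.
      by rewrite (perm_mem pe') mem_iota add0n.
    by split; apply: sub; rewrite mem_cat !inE eqxx ?orbT.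
  rewrite wseqprod_vars2 wops_swap; apply: (subspaceD sS).
    apply: (cc0 (y, x) s1 (rev t) lty ltx).
    by apply: perm_trans pe; apply/seq.permP => a; rewrite !count_cat /= count_rev; ring.
  by rewrite -wseqprod_vars2; apply: h.
pose g : freeW F := (\prod_(i <- enum 'I_n) ch (w (val i)) * ch (w n)) *:
  wseqprod (wvars F [seq val (s i) | i <- enum 'I_n]).
rewrite -[gmultilinear s w](subrK g); apply: (subspaceD sS).
  apply/IS/AI => a; rewrite (islinearB (weval_linear a)) (islinearZ (weval_linear a)).
  rewrite weval_gmultilinear ut2F_wprod; last by move=> f; apply.
  rewrite weval_wseqprod_vars -[map a _]map_comp; exact: subrr.
apply: (subspaceZ sS); apply: Sl.
rewrite map_comp -val_enum_ord; apply: perm_map; exact: perm_eq_map_perm.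
Qed.

End UT2FVariety.

(** * The Peirce decomposition in the variety of [UT2D] *)

Section UT2DVariety.
Variable F : fieldType.
Notation D := (UT2D F).
Notation e2 := (e22 F).

Definition e11 : UT2 F := 1 - e2.
Notation e1 := e11.

Let chl (w : UT2 F) : F := ut2val w 0 0.
Let chr (w : UT2 F) : F := ut2val w 1 1.

Let ut2_simp := (mulr0, mul0r, mulr1, mul1r, addr0, add0r, subr0, subrr, oppr0).

Let e22e : e2 * e2 = e2. Proof. exact: (wb_mul F b22 b22). Qed.
Let e21e : e2 * e1 = 0. Proof. by rewrite mulrBr mulr1 e22e subrr. Qed.
Let e11e : e1 * e1 = e1. Proof. by rewrite {1}/e11 mulrBl mul1r e21e subr0. Qed.

Let mul_e1 w : w * e1 = chl w *: e1.
Proof.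
by apply: UT2P; rewrite !UT2_entryM /= !mxE /= ?UT2_10 !ut2_simp.
Qed.
Let e2_mul w : e2 * w = chr w *: e2.
Proof.
by apply: UT2P; rewrite !UT2_entryM /= !mxE /= ?UT2_10 !ut2_simp.
Qed.
Let ut2E w : w = chl w *: e1 + chr w *: e2 + ut2val w 0 1 *: e12 F.
Proof.
by apply: UT2P; rewrite /= !mxE /= !ut2_simp.
Qed.

Definition peirce12 (B : walgType F) (c : B) : Prop := e1 *> c = c /\ c <* e2 = c.

Let entryD (v w : UT2 F) i j : ut2val (v + w) i j = ut2val v i j + ut2val w i j.
Proof. by rewrite /= mxE. Qed.
Let entryZ a (w : UT2 F) i j : ut2val (a *: w) i j = a * ut2val w i j.
Proof. by rewrite /= mxE. Qed.

Lemma ut2D_form : ut2_form (A := D) id id.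
Proof.
split=> // [w x x01|x w x01].
  rewrite [_ *> _]/(lactD w x) /lactD scaler0 addr0 entryD !entryZ UT2_entryM x01.
  by rewrite /= !mxE /= !ut2_simp.
rewrite [_ <* _]/(ractD x w) /ractD scaler0 addr0 entryD !entryZ UT2_entryM x01.
by rewrite /= !mxE /= !ut2_simp.
Qed.

Let lactDe1 (a : D) : e1 *> a = (e1 * a : UT2 F).
Proof.
rewrite [LHS]/(lactD _ _) /lactD /= !mxE /= !ut2_simp scale1r scaler0 addr0.
by rewrite /e11 mulrBl mul1r scaleN1r.
Qed.
Let lactDe2 (a : D) : e2 *> a = (e2 * a : UT2 F).
Proof.
rewrite [LHS]/(lactD _ _) /lactD /= !mxE /= !ut2_simp scale1r scale0r scaler0 addr0.
by rewrite add0r.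
Qed.
Let ractDe1 (a : D) : a <* e1 = (a * e1 : UT2 F).
Proof.
rewrite [LHS]/(ractD _ _) /ractD /= !mxE /= !ut2_simp scale1r scaler0 addr0.
by rewrite /e11 mulrBr mulr1 scaleN1r.
Qed.
Let ractDe2 (a : D) : a <* e2 = (a * e2 : UT2 F).
Proof.
rewrite [LHS]/(ractD _ _) /ractD /= !mxE /= !ut2_simp scale1r scale0r scaler0 addr0.
by rewrite add0r.
Qed.

Lemma peirce12_e12 : peirce12 (e12 F : D).
Proof.
split; first by rewrite lactDe1 mulrBl mul1r (wb_mul F b22 b12) subr0.
by rewrite ractDe2 (wb_mul F b12 b22).
Qed.

Section Identities.
Variable B : walgType F.
Hypothesis DB : gvar D B.
Implicit Types (b c x y : B) (w : UT2 F).

Lemma ut2D_lact12 b : e12 F *> b = 0.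
Proof.
have fE (A : walgType F) (a : nat -> A) : weval a (e12 F *> wvar F 0) = e12 F *> a 0%N.
  by rewrite weval_lact weval_var.
rewrite -[LHS](fE B (fun _ => b)); apply: DB => a; rewrite fE.
by rewrite [LHS]/(lactD _ _) /lactD /= !mxE /= subrr !scale0r scaler0 !addr0.
Qed.

Lemma ut2D_ract12 b : b <* e12 F = 0.
Proof.
have fE (A : walgType F) (a : nat -> A) : weval a (wvar F 0 <* e12 F) = a 0%N <* e12 F.
  by rewrite weval_ract weval_var.
rewrite -[LHS](fE B (fun _ => b)); apply: DB => a; rewrite fE.
by rewrite [LHS]/(ractD _ _) /ractD /= !mxE /= subrr !scale0r scaler0 !addr0.
Qed.

Lemma ut2D_peirce21 b : e2 *> b <* e1 = 0.
Proof.
have fE (A : walgType F) (a : nat -> A) :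
    weval a (e2 *> (wvar F 0 <* e1)) = e2 *> (a 0%N <* e1).
  rewrite weval_lact; congr (_ *> _).
  by rewrite weval_ract weval_var.
rewrite lract -[LHS](fE B (fun _ => b)); apply: DB => a; rewrite fE.
by rewrite ractDe1 lactDe2 mulrA e2_mul -scalerAl e21e scaler0.
Qed.

Lemma ut2D_comm1 x y : e1 *> wcomm x y <* e1 = 0.
Proof.
have fE (A : walgType F) (a : nat -> A) :
    weval a (e1 *> (wcomm_var F 0 1 <* e1)) = e1 *> (wcomm (a 0%N) (a 1%N) <* e1).
  rewrite weval_lact; congr (_ *> _).
  by rewrite weval_ract weval_wcomm_var.
pose b i := nth 0 [:: x; y] i.
rewrite lract -[LHS](fE B b); apply: DB => a; rewrite fE.
rewrite ractDe1 lactDe1 mul_e1 -scalerAr.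
by rewrite [chl _](ut2_comm_diag (a 0%N : UT2 F) (a 1%N)) scale0r.
Qed.

Lemma ut2D_comm2 x y : e2 *> wcomm x y <* e2 = 0.
Proof.
have fE (A : walgType F) (a : nat -> A) :
    weval a (e2 *> (wcomm_var F 0 1 <* e2)) = e2 *> (wcomm (a 0%N) (a 1%N) <* e2).
  rewrite weval_lact; congr (_ *> _).
  by rewrite weval_ract weval_wcomm_var.
pose b i := nth 0 [:: x; y] i.
rewrite lract -[LHS](fE B b); apply: DB => a; rewrite fE.
rewrite ractDe2 lactDe2 mulrA e2_mul -scalerAl.
by rewrite [chr _](ut2_comm_diag (a 0%N : UT2 F) (a 1%N)) scale0r.
Qed.

Lemma lact_e1 b : e1 *> b = b - e2 *> b.
Proof. by rewrite (islinearB (lact_linl b)) lact1. Qed.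
Lemma ract_e1 b : b <* e1 = b - b <* e2.
Proof. by rewrite (islinearB (ract_linr b)) ract1. Qed.

Lemma ut2D_lactE w b : w *> b = chl w *: (e1 *> b) + chr w *: (e2 *> b).
Proof.
rewrite {1}(ut2E w) 2!(islinearD (lact_linl b)) !(islinearZ (lact_linl b)).
by rewrite ut2D_lact12 scaler0 addr0.
Qed.

Lemma ut2D_ractE b w : b <* w = chl w *: (b <* e1) + chr w *: (b <* e2).
Proof.
rewrite {1}(ut2E w) 2!(islinearD (ract_linr b)) !(islinearZ (ract_linr b)).
by rewrite ut2D_ract12 scaler0 addr0.
Qed.

Lemma peirce12_lact2 c : peirce12 c -> e2 *> c = 0.
Proof. by case=> <- _; rewrite -lactM e21e lact0l. Qed.

Lemma peirce12_ract1 c : peirce12 c -> c <* e1 = 0.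
Proof. by case=> _ <-; rewrite -ractM e21e ract0r. Qed.

Lemma peirce12_mid b : peirce12 (e1 *> b <* e2).
Proof.
by split; [rewrite -lract -lactM e11e | rewrite -ractM e22e].
Qed.

(** Since e22 B e11 = 0, the space e11 B e22 is an ideal, of square zero because e22 e11 = 0.
    Commutators lie in it, having no component in e11 B e11 or e22 B e22. *)
Lemma peirce12_split : split_ideal chl chr (@peirce12 B).
Proof.
split.
- split=> [|a u v [u1 u2] [v1 v2]]; first by split; rewrite ?lact0r ?ract0l.
  by split; rewrite ?lact_linr ?ract_linl ?u1 ?u2 ?v1 ?v2.
- move=> x c [c1 c2]; split; last by rewrite ract_mul c2.
  have h : e2 *> (x ** c) = 0.
    by rewrite lact_mul -c1 -mul_ract_lact ut2D_peirce21 wmul0l.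
  by rewrite lact_e1 h subr0.
- move=> c x [c1 c2]; split; first by rewrite lact_mul c1.
  have : (c ** x) <* e1 = 0.
    by rewrite ract_mul -c2 mul_ract_lact -lract ut2D_peirce21 wmul0r.
  by rewrite ract_e1 => /subr0_eq <-.
- move=> x y; set c := wcomm x y.
  have h2 : e2 *> c = 0.
    by rewrite -[LHS](subrK (e2 *> c <* e2)) -ract_e1 ut2D_peirce21 ut2D_comm2 addr0.
  have : c <* e1 = 0.
    rewrite -[LHS](subrK (e2 *> (c <* e1))) -lact_e1 -!lract.
    by rewrite ut2D_peirce21 ut2D_comm1 addr0.
  rewrite ract_e1 => /subr0_eq h1.
  by split; rewrite ?lact_e1 ?h2 ?subr0.
- move=> c d [c1 c2] [d1 d2]; rewrite -c2 -d1 mul_ract_lact -lactM.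
  by rewrite e21e lact0l wmul0r.
- by move=> w c [c1 c2]; rewrite -{1}c1 -lactM mul_e1 (islinearZ (lact_linl _)) c1.
- by move=> c w [c1 c2]; rewrite -{1}c2 -ractM e2_mul (islinearZ (ract_linr _)) c2.
Qed.

(** A swap changes the product by an element of e11 B e22, which right multiplication by e11
    kills. *)
Lemma peirce11_perm (s t : seq B) : perm_eq s t ->
  e1 *> wseqprod s <* e1 = e1 *> wseqprod t <* e1.
Proof.
move=> st; apply: (perm_swap_ind (P := fun t => _ = e1 *> wseqprod t <* e1)) st _ => //.
move=> {t} {}s x y t ->; rewrite !wseqprod_cat2E wops_swap.
rewrite (islinearD (lact_linr _)) (islinearD (ract_linl _)) addrC.
rewrite -[RHS]addr0; congr (_ + _); rewrite lract peirce12_ract1 ?lact0r //.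
apply: (split_wops peirce12_split); exact: split_comm peirce12_split _ _.
Qed.

Lemma peirce22_perm (s t : seq B) : perm_eq s t ->
  e2 *> wseqprod s <* e2 = e2 *> wseqprod t <* e2.
Proof.
move=> st; apply: (perm_swap_ind (P := fun t => _ = e2 *> wseqprod t <* e2)) st _ => //.
move=> {t} {}s x y t ->; rewrite !wseqprod_cat2E wops_swap.
rewrite (islinearD (lact_linr _)) (islinearD (ract_linl _)) addrC.
rewrite -[RHS]addr0; congr (_ + _); rewrite peirce12_lact2 ?ract0l //.
apply: (split_wops peirce12_split); exact: split_comm peirce12_split _ _.
Qed.

Lemma peirce11_mul b x : ((e1 *> b <* e1) ** x) <* e1 = e1 *> (b ** x) <* e1.
Proof.
have h : (b <* e2) ** (x <* e1) = 0.
  by rewrite mul_ract_lact -lract ut2D_peirce21 wmul0r.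
rewrite ract_mul lract -lact_mul (ract_e1 b) wmulBl h subr0.
by rewrite -ract_mul lract.
Qed.

Lemma peirce22_mul b x : ((e2 *> b <* e2) ** x) <* e2 = e2 *> (b ** x) <* e2.
Proof.
have h : (e2 *> b <* e1) ** (x <* e2) = 0 by rewrite ut2D_peirce21 wmul0l.
have -> : e2 *> b <* e2 = e2 *> b - e2 *> b <* e1 by rewrite ract_e1 opprB addrC subrK.
by rewrite ract_mul wmulBl h subr0 -lact_mul -ract_mul lract.
Qed.

Lemma peirce12_mul b x :
  ((e1 *> b <* e1) ** x) <* e2 = b ** (e1 *> x <* e2).
Proof.
rewrite ract_mul mul_ract_lact -lact_mul -lract.
by have [-> _] := split_mull peirce12_split b (peirce12_mid x).
Qed.

Lemma peirce21_mul b x : ((b <* e2) ** x) <* e1 = 0.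
Proof. by rewrite ract_mul mul_ract_lact -lract ut2D_peirce21 wmul0r. Qed.

End Identities.

Definition wfold (B : walgType F) (h : UT2 F * B) (t : seq (UT2 F * B)) : B :=
  foldl (fun m p => m ** (p.1 *> p.2)) (h.1 *> h.2) t.

Lemma wfold_rcons (B : walgType F) (h : UT2 F * B) t w (x : B) : gvar D B ->
  wfold h (rcons t (w, x)) =
  chl w *: ((wfold h t <* e1) ** x) + chr w *: ((wfold h t <* e2) ** x).
Proof.
move=> DB; rewrite /wfold -cats1 foldl_cat /= (ut2D_lactE DB w).
by rewrite wmulDr !wmulZr -!mul_ract_lact.
Qed.

(* Modulo e22 B e11 = 0, a product of n factors is a sum over the position k at
   which the Peirce index switches from 1 to 2: the k-th factor contributes its
   component e11 x_k e22 and the others act on it by multiplication. *)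
Lemma wfold_peirce (h : UT2 F * nat) (t : seq (UT2 F * nat)) :
  exists (k1 k2 : F) (r : seq (F * nat * seq nat * seq nat)),
    all (fun q => perm_eq (q.1.2 ++ q.2 ++ [:: q.1.1.2]) [seq p.2 | p <- h :: t]) r /\
    forall B : walgType F, gvar D B -> forall a : nat -> B,
      let M := wfold (h.1, a h.2) [seq (p.1, a p.2) | p <- t] in
      let p := wseqprod [seq a p.2 | p <- h :: t] in
      M <* e1 = k1 *: (e1 *> p <* e1) /\
      M <* e2 = k2 *: (e2 *> p <* e2) + \sum_(q <- r) q.1.1.1 *:
        wops (wletters (map a q.1.2) [::] (map a q.2)) (e1 *> a q.1.1.2 <* e2).
Proof.
elim/last_ind: t => [|t [w x] [k1 [k2 [r [rP IH]]]]].
  exists (chl h.1), (chr h.1), [:: (chl h.1, h.2, [::], [::])].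
  split=> [|B DB a /=]; first by rewrite /= perm_refl.
  rewrite /wfold /= big_seq1 (ut2D_lactE DB h.1).
  rewrite !(islinearD (ract_linl _)) !(islinearZ (ract_linl _)).
  split; first by rewrite (ut2D_peirce21 DB) scaler0 addr0.
  by rewrite addrC.
(* The new letter [x] either is the switching position, preceded by all earlier letters, or comes
   after the switch and acts by right multiplication. *)
exists (chl w * k1), (chr w * k2),
  ((chl w * k1, x, [seq p.2 | p <- h :: t], [::]) ::
   [seq (chr w * q.1.1.1, q.1.1.2, q.1.2, x :: q.2) | q <- r]).
split=> [|B DB a].
  rewrite -rcons_cons map_rcons -cats1 [all _ _]/= perm_refl all_map /=.
  apply: sub_all rP => q /= pq.
  rewrite -(perm_cat2r [:: x]) in pq; apply: perm_trans pq.
  by apply/seq.permP => b; rewrite !count_cat /= !count_cat /=; ring.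
have [] := IH B DB a; set M := wfold _ _; set p := wseqprod _ => M1 M2 M' p'.
have -> : M' = chl w *: ((M <* e1) ** a x) + chr w *: ((M <* e2) ** a x).
  by rewrite -wfold_rcons // /M' map_rcons.
have -> : p' = p ** a x.
  by rewrite /p' -rcons_cons map_rcons /p /= -cats1 foldl_cat.
rewrite !(islinearD (ract_linl _)) !(islinearZ (ract_linl _)).
split.
  rewrite (peirce21_mul DB) scaler0 addr0 M1 wmulZl (islinearZ (ract_linl _)).
  by rewrite (peirce11_mul DB) scalerA.
rewrite M1 wmulZl (islinearZ (ract_linl _)) (peirce12_mul DB) scalerA.
rewrite M2 wmulDl wmulZl (islinearD (ract_linl _)) (islinearZ (ract_linl _)).
rewrite (peirce22_mul DB) scalerDr scalerA addrCA; congr (_ + _).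
rewrite big_cons big_map; congr (_ + _).
  congr (_ *: _); rewrite -[wops _ _]/(wops ([seq (Some true, y) | y <-
    [seq a i | i <- [seq p.2 | p <- h :: t]]] ++ [::]) (e1 *> a x <* e2)).
  by rewrite cats0 -[map a _]map_comp wopsLE.
have pC := peirce12_split DB.
rewrite (islinear_sum (wmul_linl _)) (islinear_sum (ract_linl _)) scaler_sumr.
apply: eq_bigr => q _; rewrite wmulZl (islinearZ (ract_linl _)) scalerA; congr (_ *: _).
set c := e1 *> _ <* e2; set l := wops _ c.
have Cl : peirce12 l by apply: (split_wops pC); apply: peirce12_mid.
have [_ ->] := split_mulr pC (a x) Cl.
rewrite /l /wletters !wops_cat; exact: wop_wopsL.
Qed.

Definition mid_var (k : nat) : freeW F := e1 *> wvar F k <* e2.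

Lemma weval_mid_var (B : walgType F) (a : nat -> B) k :
  weval a (mid_var k) = e1 *> a k <* e2.
Proof. by rewrite weval_ract weval_lact weval_var. Qed.

Lemma almost_polynomial_growth_ut2D : [pchar F] =i pred0 ->
  almost_polynomial_growth (gvar D).
Proof.
move=> charF; pose ee b := if b then e1 else e2.
apply: (almost_polynomial_growth_ut2 (CC := peirce12)
  (us := fun j => [:: j.1]) (cc := fun j => mid_var j.1)
  (ex := fun n b => ee b *> wseqprod (wvars F (iota 0 n)) <* ee b)
  charF ut2D_form _ peirce12_split).
- exact: peirce12_e12.
- by move=> B EB a j; rewrite weval_mid_var; exact: peirce12_mid.
move=> n I S AI sS IS ex0 cc0 s w.
(* In degree 0 the element is the default value 0 of [wprod]. *)
case: n s => [|n] s in ex0 cc0 *.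
  by rewrite /gmultilinear /wprod enum_ord0 /=; case: sS.
pose l := [seq (w (val i), val (s i)) | i <- enum 'I_n.+1].
have lE : [seq p.2 | p <- l] = [seq val (s i) | i <- enum 'I_n.+1] by rewrite -map_comp.
have l_perm : perm_eq [seq p.2 | p <- l] (iota 0 n.+1).
  by rewrite lE map_comp -val_enum_ord; apply: perm_map; exact: perm_eq_map_perm.
have gE (B : walgType F) (a : nat -> B) :
    weval a (gmultilinear s w) = wprod [seq (p.1, a p.2) | p <- l] (w n.+1).
  by rewrite weval_gmultilinear -[in RHS]map_comp.
case: l lE l_perm gE => [|h t] lE l_perm gE.
  by move: (perm_size l_perm); rewrite size_iota.
have [k1 [k2 [r [rP hP]]]] := wfold_peirce h t.
(* The final coefficient weights the two components supplied by [wfold_peirce]. Their diagonal parts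
   may be sorted, which gives the two exceptional elements; the rest are operator words on
   [mid_var]. *)
pose g : freeW F := (chl (w n.+1) * k1) *: (e1 *> wseqprod (wvars F (iota 0 n.+1)) <* e1)
  + ((chr (w n.+1) * k2) *: (e2 *> wseqprod (wvars F (iota 0 n.+1)) <* e2)
  + chr (w n.+1) *: \sum_(q <- r) q.1.1.1 *:
      wops (wletter_vars F q.1.2 [::] q.2) (mid_var q.1.1.2)).
rewrite -[gmultilinear s w](subrK g); apply: (subspaceD sS).
  apply/IS/AI => a; rewrite (islinearB (weval_linear a)) gE.
  have DD : gvar D D by move=> f; apply.
  have -> : weval a g =
      (chl (w n.+1) * k1) *: (e1 *> wseqprod [seq a i | i <- iota 0 n.+1] <* e1)
      + ((chr (w n.+1) * k2) *: (e2 *> wseqprod [seq a i | i <- iota 0 n.+1] <* e2)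
      + chr (w n.+1) *: \sum_(q <- r) q.1.1.1 *:
         wops (wletters (map a q.1.2) [::] (map a q.2)) (e1 *> a q.1.1.2 <* e2)).
    have lin3 x y z (u v f : freeW F) : weval a (x *: u + (y *: v + z *: f)) =
        x *: weval a u + (y *: weval a v + z *: weval a f).
      by rewrite !weval_linear (islinearZ (weval_linear a)).
    have side e f : weval a (e *> f <* e) = e *> weval a f <* e.
      by rewrite weval_ract weval_lact.
    rewrite /g lin3 !side weval_wseqprod_vars.
    congr (_ + (_ + _ *: _)); rewrite (islinear_sum (weval_linear a)).
    apply: eq_bigr => q _; rewrite (islinearZ (weval_linear a)) weval_wletters.
    by rewrite weval_mid_var.
  have [M1 M2] := hP D DD a; apply/eqP; rewrite subr_eq0; apply/eqP.
  have pa := perm_map a l_perm; rewrite -map_comp in pa.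
  rewrite -(peirce11_perm DD pa) -(peirce22_perm DD pa).
  transitivity (wfold (h.1, a h.2) [seq (p.1, a p.2) | p <- t] <* w n.+1) => //.
  by rewrite (ut2D_ractE DD) M1 M2 [X in _ + X]scalerDr !scalerA.
apply: (subspaceD sS); first exact: (subspaceZ sS _ (ex0 true)).
apply: (subspaceD sS); first exact: (subspaceZ sS _ (ex0 false)).
apply: (subspaceZ sS); elim: r rP {hP g} => [|q r IH] /=.
  by rewrite big_nil; case: sS.
case/andP=> pq /IH Sr; rewrite big_cons; apply: (subspaceD sS) Sr.
have {}pq := perm_trans pq l_perm.
have lt_q : (q.1.1.2 < n.+1)%N.
  have : q.1.1.2 \in iota 0 n.+1 by rewrite -(perm_mem pq) !mem_cat inE eqxx !orbT.
  by rewrite mem_iota.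
exact: (subspaceZ sS _ (cc0 (q.1.1.2, q.1.1.2) _ _ lt_q lt_q pq)).
Qed.

End UT2DVariety.

(** The identity e22 x = 0 of [UT2F] fails in [UT2D] at x = 1. *)
Lemma gvar_ut2F_ut2D (F : fieldType) : ~ gvar (UT2F F) (UT2D F).
Proof.
move=> FD; have := ut2F_lact (e22 F) ((1 : UT2 F) : UT2D F) FD.
rewrite [LHS]/(lactD _ _) => /(congr1 (fun v => ut2val v 1 1)).
rewrite /lactD scaler0 addr0 mulr1 /= !mxE /= !(mulr0, mul0r, mulr1, add0r, subr0).
by move=> /eqP; rewrite oner_eq0.
Qed.

Theorem corollary5p11 (F : fieldType) (charF : [pchar F] =i pred0) :
  [/\ ~ eqclass (gvar (UT2F F)) (gvar (UT2D F)),
      almost_polynomial_growth (gvar (UT2F F)) &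
      almost_polynomial_growth (gvar (UT2D F))].
Proof.
split.
- by case=> _ DF; apply: (@gvar_ut2F_ut2D F); apply: DF => f; apply.
- exact: almost_polynomial_growth_ut2F.
- exact: almost_polynomial_growth_ut2D.
Qed.
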